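(* Assume that for each $j\in\{1,2\}$, every $0<h\le h_0$ and every $g_h\in V_h'$, the discrete linear problem ''find $w_h\in V_h$ with $a_j(w_h,\phi_h)=\langle g_h,\phi_h\rangle$ for all $\phi_h\in V_h$'' has a unique solution, and this solution satisfies $\|w_h\|_V\le M_{\rm lin}\|g_h\|_{V_h'}$. Let $\rho>0$ satisfy $$\widehat M_1\|\ell\|_{V'}+\theta_\rho\,\rho\le\rho,\qquad q_\rho<1 .$$ Then the continuous nonlinear problem: find $(u_1,u_2)\in V\times V$ such that $$a_1(u_1,\xi)=\int_{B_R}\chi_1\overline{u_1}u_2\overline{\xi}\,dx+\ell(\xi)\quad\forall \xi\in V,\qquad a_2(u_2,\eta)=\int_{B_R}\chi_2u_1^2\overline{\eta}\,dx\quad\forall\eta\in V,$$ has a unique solution $(u_1,u_2)$ in $$\mathcal B_\rho:=\{(u,v)\in V\times V:\ \|u\|_V\le\rho,\ \|v\|_V\le\sigma_\rho\}.$$ Moreover, for every $0<h\le h_0$, the discrete nonlinear problem: find $(u_{1,h},u_{2,h})\in V_h\times V_h$ such that $$a_1(u_{1,h},\xi_h)=\int_{B_R}\chi_1\overline{u_{1,h}}u_{2,h}\overline{\xi_h}\,dx+\ell(\xi_h)\quad\forall \xi_h\in V_h,\qquad a_2(u_{2,h},\eta_h)=\int_{B_R}\chi_2u_{1,h}^2\overline{\eta_h}\,dx\quad\forall\eta_h\in V_h,$$ has a unique solution $(u_{1,h},u_{2,h})$ in $$\mathcal B_{\rho,h}:=\{(u_h,v_h)\in V_h\times V_h:\ \|u_h\|_V\le\rho,\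 \|v_h\|_V\le\sigma_\rho\}.$$
   Context: Setting. Let $d\in\{2,3\}$, let $D\subset\mathbb R^d$ be a bounded Lipschitz domain, and let $R>0$ be such that $\overline D\subset B_R$, where $B_R$ is the ball of radius $R$ centered at the origin, with boundary $\Gamma_R$ and outward unit normal $\nu$. Let $\kappa_1>0$ and $\kappa_2:=2\kappa_1$. For $j=1,2$ let $n_j\in L^\infty(B_R;\mathbb R)$ with $0<n_{\min}\le n_j\le n_{\max}<\infty$ a.e. and $n_j=1$ outside $\overline D$; let $\chi_j\in L^\infty(\mathbb R^d)$ be real-valued, nonnegative and supported in $\overline D$. Let $u^i(x)=\exp(i\kappa_1 d_0\cdot x)$ with $d_0\in\mathbb S^{d-1}$. Spaces. $V:=H^1(B_R;\mathbb C)$ with $\|\cdot\|_V:=\|\cdot\|_{H^1(B_R)}$; $V'$ is the anti-dual of $V$ (continuous conjugate-linear functionals, with the dual norm); $\gamma:V\to H^{1/2}(\Gamma_R)$ is the trace; $\langle\cdot,\cdot\rangle_{\Gamma_R}$ is the duality pairing of $H^{-1/2}(\Gamma_R)$ and $H^{1/2}(\Gamma_R)$, linear in the first and conjugate-linear in the second argument; $\langle F,v\rangle$ denotes the pairing of an anti-dual with its space, linear in $F$ and conjugate-linear in $v$. DtN map. For $k>0$ and $g\in H^{1/2}(\Gamma_R)$ let $w_g$ be the unique solution of $\Delta w_g+k^2w_g=0$ in $\mathbb R^d\setminus\overline{B_R}$, $w_g=g$ on $\Gamma_R$, satisfying the radiation condition $\lim_{r=|x|\to\infty}r^{(d-1)/2}(\partial_r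 w_g-ikw_g)=0$ uniformly in $x/|x|$. Set $T_kg:=\partial_\nu w_g|_{\Gamma_R}$; $T_k:H^{1/2}(\Gamma_R)\to H^{-1/2}(\Gamma_R)$ is bounded. Forms and data. For $j=1,2$, $a_j(w,\xi):=\int_{B_R}(\nabla w\cdot\nabla\overline\xi-\kappa_j^2n_jw\overline\xi)\,dx-\langle T_{\kappa_j}\gamma w,\gamma\xi\rangle_{\Gamma_R}$ on $V\times V$. The functional $\ell\in V'$ is $\ell(\xi):=\langle f_R,\gamma\xi\rangle_{\Gamma_R}$ with $f_R:=\partial_\nu u^i-T_{\kappa_1}(\gamma u^i)$. Continuous linear stability (known fact). For $j=1,2$ the operator $A_j:V\to V'$, $\langle A_jw,\phi\rangle:=a_j(w,\phi)$, is an isomorphism; $M_j>0$ is a constant with $\|A_j^{-1}g\|_V\le M_j\|g\|_{V'}$ for all $g\in V'$. Product constant. $C_{\rm prod}>0$ is a constant, depending only on $B_R$ and $d$, with $\|w\|_{L^4(B_R)}\|z\|_{L^4(B_R)}\|\phi\|_{L^2(B_R)}\le C_{\rm prod}\|w\|_V\|z\|_V\|\phi\|_V$ for all $w,z,\phi\in V$ (it exists by the embedding $H^1(B_R)\hookrightarrow L^4(B_R)$). Finite element spaces. $\{\mathcal T_h\}_{h>0}$ is a family of shape-regular conforming meshes of $B_R$ by triangles ($d=2$) or tetrahedra ($d=3$), curvilinear at $\Gamma_R$; $V_h\subset V$ is a (finite-dimensional) conforming space of piecewise polynomials of degree $p\ge1$ on $\mathcal T_h$, equipped with $\|\cdot\|_V$,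 with anti-dual $V_h'$ and its dual norm. The family is dense: $\inf_{z_h\in V_h}\|v-z_h\|_V\to0$ as $h\to0$ for every $v\in V$. The constants $h_0>0$ and $M_{\rm lin}>0$ are independent of $h$. Derived constants. $\widehat M_j:=\max\{M_j,M_{\rm lin}\}$, and for $r>0$: $\alpha_r:=\widehat M_1C_{\rm prod}\|\chi_1\|_{L^\infty(B_R)}r$, $\beta_r:=2\widehat M_2C_{\rm prod}\|\chi_2\|_{L^\infty(B_R)}r$, $\sigma_r:=\beta_rr/2$, $\theta_r:=\widehat M_1C_{\rm prod}\|\chi_1\|_{L^\infty(B_R)}\sigma_r=\alpha_r\beta_r/2$, $q_r:=\theta_r+\alpha_r\beta_r=\tfrac32\alpha_r\beta_r$. *)

(* Defs.v *)
From HB Require Import structures.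
From mathcomp Require Import all_boot all_order all_algebra.
From mathcomp Require Import complex.
From mathcomp Require Import all_classical all_reals all_analysis.
Set Implicit Arguments.
Unset Strict Implicit.
Unset Printing Implicit Defensive.
Import Order.TTheory GRing.Theory Num.Theory.
Import numFieldNormedType.Exports.
Local Open Scope classical_set_scope.
Local Open Scope ring_scope.
Local Open Scope complex_scope.

Definition rV_display : measure_display -> measure_display.
Proof. exact. Qed.

Section measurable_rV.
Context (R : realType) (n : nat).

Definition rV_coord (i : 'I_n) (v : 'rV[R]_n) : R := v ord0 i.

Let rV_set0 : g_sigma_preimage rV_coord set0.
Proof. exact: sigma_algebra0. Qed.

Let rV_setC A : g_sigma_preimage rV_coord A -> g_sigma_preimage rV_coord (~` A).
Proof. exact: sigma_algebraC. Qed.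

Let rV_bigcup (F : _^nat) : (forall i, g_sigma_preimage rV_coord (F i)) ->
  g_sigma_preimage rV_coord (\bigcup_i (F i)).
Proof. exact: sigma_algebra_bigcup. Qed.

HB.instance Definition _ :=
  @isMeasurable.Build (rV_display default_measure_display)
  'rV[R]_n (g_sigma_preimage rV_coord) rV_set0 rV_setC rV_bigcup.

Lemma measurable_rV_coord (i : 'I_n) : measurable_fun setT (rV_coord i).
Proof.
move=> _ Y mY; rewrite setTI; apply: sub_sigma_algebra => /=.
rewrite -bigcup_seq/=; exists i => /=; first by rewrite mem_index_enum.
by exists Y => //; rewrite setTI.
Qed.

Lemma measurable_to_rV d (T : measurableType d) (f : T -> 'rV[R]_n) :
  (forall i, measurable_fun setT (rV_coord i \o f)) -> measurable_fun setT f.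
Proof.
move=> mf; apply: (@measurability _ _ _ _ _ _
  (\big[setU/set0]_(i < n) preimage_set_system setT (rV_coord i) measurable)) => //.
move=> _ [B + <-]; rewrite -bigcup_seq/= => -[i _ [C mC <-]].
rewrite setTI; have := mf i measurableT C mC.
by rewrite !setTI.
Qed.

End measurable_rV.

Section lebesgue_rV.
Context (R : realType).

Definition rV_snoc n (p : 'rV[R]_n * measurableTypeR R) : 'rV[R]_n.+1 :=
  \row_i (if unlift ord_max i is Some j then p.1 ord0 j else p.2).

Lemma measurable_rV_snoc n : measurable_fun setT (@rV_snoc n).
Proof.
apply: measurable_to_rV => i; case: (unliftP ord_max i) => [j ij|ij].
  rewrite (_ : _ \o _ = rV_coord j \o fst).
    by apply: measurableT_comp => //; exact: measurable_rV_coord.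
  by apply/funext => p; rewrite /= /rV_coord mxE ij liftK.
rewrite (_ : _ \o _ = snd) //.
by apply/funext => p; rewrite /= /rV_coord mxE ij unlift_none.
Qed.

HB.instance Definition _ n := isMeasurableFun.Build _ _ _ _ (@rV_snoc n)
  (@measurable_rV_snoc n).

Section succ.
Context (n : nat) (mu : {measure set 'rV[R]_n -> \bar R}).

Definition rV_lebesgue_succ : set 'rV[R]_n.+1 -> \bar R :=
  pushforward (mu \x (@lebesgue_measure R))%E (@rV_snoc n).

Let succ0 : rV_lebesgue_succ set0 = 0%E.
Proof. exact: measure0. Qed.

Let succ_ge0 A : (0 <= rV_lebesgue_succ A)%E.
Proof. exact: measure_ge0. Qed.

Let succ_sigma_additive : semi_sigma_additive rV_lebesgue_succ.
Proof. exact: measure_semi_sigma_additive. Qed.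

HB.instance Definition _ := isMeasure.Build _ _ _ rV_lebesgue_succ
  succ0 succ_ge0 succ_sigma_additive.
End succ.

Fixpoint leb (n : nat) : {measure set 'rV[R]_n -> \bar R} :=
  match n with
  | 0 => \d_(0 : 'rV[R]_0)
  | m.+1 => rV_lebesgue_succ (leb m)
  end.

End lebesgue_rV.

Section calculus.
Context (R : realType) (d : nat).
Local Notation E := 'rV[R]_d.

(* The regular module structure [^o] makes spaces of complex-valued functions
   left modules over R[i]. *)
Definition cfun := E -> (R[i])^o.

Definition cabs (z : R[i]) : R := ComplexField.Normc.normc z.

Definition dot (x y : E) : R := \sum_i x ord0 i * y ord0 i.

(* The library norm on 'rV[R]_d is the sup norm, hence: *)
Definition enorm (x : E) : R := Num.sqrt (dot x x).

Definition eball (r : R) : set E := [set x | enorm x < r].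
Definition esphere (r : R) : set E := [set x | enorm x = r].
Definition exterior (r : R) : set E := [set x | r < enorm x].
Definition annulus (r s : R) : set E := [set x | r < enorm x < s].

Definition Refun (w : cfun) : E -> R := fun x => complex.Re (w x).
Definition Imfun (w : cfun) : E -> R := fun x => complex.Im (w x).

Definition partial (i : 'I_d) (f : E -> R) : E -> R :=
  fun x => 'D_(delta_mx ord0 i) f x.
Definition cpartial (i : 'I_d) (w : cfun) : cfun :=
  fun x => partial i (Refun w) x +i* partial i (Imfun w) x.
Definition claplacian (w : cfun) : cfun :=
  fun x => \sum_i cpartial i (cpartial i w) x.

Definition iter_partial (s : seq 'I_d) (f : E -> R) : E -> R :=
  foldr partial f s.

(* f is of class C^m on the open set A. *)
Definition Ck (m : nat) (A : set E) (f : E -> R) : Prop :=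
  forall s : seq 'I_d, (size s <= m)%N -> forall x, A x ->
    {for x, continuous (iter_partial s f)} /\
    ((size s < m)%N -> differentiable (iter_partial s f) x).
Definition cCk (m : nat) (A : set E) (w : cfun) : Prop :=
  Ck m A (Refun w) /\ Ck m A (Imfun w).
Definition smooth (f : E -> R) : Prop := forall m, Ck m setT f.
Definition csmooth (w : cfun) : Prop := smooth (Refun w) /\ smooth (Imfun w).

Definition test_function (A : set E) (f : E -> R) : Prop :=
  smooth f /\ exists K : set E,
    [/\ compact K, K `<=` A & forall x, ~ K x -> f x = 0].
Definition ctest_function (A : set E) (w : cfun) : Prop :=
  test_function A (Refun w) /\ test_function A (Imfun w).

Definition cint (A : set E) (w : E -> R[i]) : R[i] :=
  (\int[leb R d]_(x in A) complex.Re (w x)) +i* (\int[leb R d]_(x in A) complex.Im (w x)).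

Definition ae_eq_on (A : set E) (u v : cfun) : Prop :=
  {ae leb R d, forall x, A x -> u x = v x}.

Definition L2 (A : set E) (w : cfun) : Prop :=
  [/\ measurable_fun A (Refun w), measurable_fun A (Imfun w) &
      (\int[leb R d]_(x in A) (cabs (w x) ^+ 2)%:E < +oo)%E].

(* The L^p(A) norm; it may be +oo. *)
Definition LpN (p : \bar R) (A : set E) (w : cfun) : \bar R :=
  Lnorm (leb R d) p (fun x => (cabs (w x) * \1_A x)%:E).

Definition LooN (A : set E) (f : E -> R) : \bar R :=
  Lnorm (leb R d) +oo%E (fun x => (f x * \1_A x)%:E).

Definition Loo (f : E -> R) : Prop :=
  measurable_fun setT f /\ (LooN setT f < +oo)%E.

End calculus.

Section antidual.
Context (R : realType) (X : lmodType R[i]).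

(* F restricts to a continuous conjugate-linear functional on the subspace W
   normed by N; the values of F outside W are irrelevant. *)
Definition antidual (W : set X) (N : X -> R) (F : X -> R[i]) : Prop :=
  (forall (c : R[i]) u v, W u -> W v -> F (c *: u + v) = conjc c * F u + F v) /\
  (exists K : R, forall u, W u -> cabs (F u) <= K * N u).

Definition dual_norm (W : set X) (N : X -> R) (F : X -> R[i]) : R :=
  sup [set cabs (F u) | u in [set u | W u /\ N u <= 1]].

(* For every F in the antidual of W, the problem a(w, _) = F on W has a solution
   w in W, unique up to the equality eqW of W. *)
Definition uniquely_solvable (W : set X) (N : X -> R)
    (eqW : X -> X -> Prop) (a : X -> X -> R[i]) : Prop :=
  forall F, antidual W N F ->
    exists w, [/\ W w, forall phi, W phi -> a w phi = F phi &
      forall z, W z -> (forall phi, W phi -> a z phi = F phi) -> eqW z w].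

(* A w = a(w, _) restricts to a bounded linear bijection from W onto its
   antidual. *)
Definition antidual_isomorphism (W : set X) (N : X -> R)
    (eqW : X -> X -> Prop) (a : X -> X -> R[i]) : Prop :=
  [/\ forall w, W w -> antidual W N (a w),
      forall (c : R[i]) w z phi, W w -> W z -> W phi ->
        a (c *: w + z) phi = c * a w phi + a z phi,
      exists K : R, forall w, W w -> dual_norm W N (a w) <= K * N w &
      uniquely_solvable W N eqW a].

Definition stability_bound (W : set X) (N : X -> R) (a : X -> X -> R[i])
    (M : R) : Prop :=
  forall F, antidual W N F -> forall w, W w ->
    (forall phi, W phi -> a w phi = F phi) -> N w <= M * dual_norm W N F.

End antidual.

Section sobolev.
Context (R : realType) (d : nat).
Local Notation E := 'rV[R]_d.
Local Notation cfun := (cfun R d).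

(* An H^1 function is carried together with its weak gradient. *)
Definition jet : Type := (cfun * ('I_d -> cfun))%type.
HB.instance Definition _ := GRing.Lmodule.on jet.

Definition jet_of (w : cfun) : jet := (w, fun i => cpartial i w).

Definition H1 (A : set E) : set jet := [set w |
  [/\ L2 A w.1, forall i, L2 A (w.2 i) &
      forall (i : 'I_d) (f : E -> R), test_function A f ->
        cint A (fun x => w.1 x * (partial i f x)%:C) =
        - cint A (fun x => w.2 i x * (f x)%:C)]].

Definition normH1 (A : set E) (w : jet) : R :=
  Num.sqrt (\int[leb R d]_(x in A)
    (cabs (w.1 x) ^+ 2 + \sum_i cabs (w.2 i x) ^+ 2)).

Definition eqH1 (A : set E) (u v : jet) : Prop := ae_eq_on A u.1 v.1.

Context (rad : R).
Local Notation B := (eball rad).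
Local Notation Gamma := (esphere rad).

(** Functions on the sphere of radius rad are functions on R^d of which only
    the values on the sphere are used. The surface measure sigma is the cone
    measure
      sigma S = (d / rad) * Lebesgue {x in B | rad x / |x| in S}. *)

Definition sphere_proj (x : E) : E := (rad / enorm x) *: x.

Definition surface_int (g : cfun) : R[i] :=
  (d%:R / rad)%:C * cint B (g \o sphere_proj).

Definition L2Gamma (g : cfun) : Prop := L2 B (g \o sphere_proj).
Definition normL2Gamma (g : cfun) : R :=
  Num.sqrt (d%:R / rad * \int[leb R d]_(x in B) (cabs (g (sphere_proj x)) ^+ 2)).

(* The square of the Sobolev-Slobodeckij seminorm of order 1/2:
   iint |g x - g y|^2 / |x - y|^d dsigma(y) dsigma(x). *)
Definition gagliardo (g : cfun) : \bar R :=
  (((d%:R / rad) ^+ 2)%R%:E * \int[leb R d]_(x in B) \int[leb R d]_(y in B)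
    (cabs (g (sphere_proj x) - g (sphere_proj y)) ^+ 2 /
     enorm (sphere_proj x - sphere_proj y) ^+ d)%R%:E)%E.

Definition H12 : set cfun := [set g | L2Gamma g /\ (gagliardo g < +oo)%E].
Definition normH12 (g : cfun) : R :=
  Num.sqrt (normL2Gamma g ^+ 2 + fine (gagliardo g)).

(* g is the trace on the sphere of the H^1(A) function w, where A is bounded and
   lies on one side of the sphere: g is the L^2 limit of the restrictions of
   smooth functions which converge to w in H^1(A). *)
Definition is_trace (A : set E) (w : jet) (g : cfun) : Prop :=
  L2Gamma g /\ exists f : nat -> cfun,
    [/\ forall n, csmooth (f n),
        normH1 A (w - jet_of (f n)) @[n --> \oo] --> (0 : R) &
        normL2Gamma (g - f n) @[n --> \oo] --> (0 : R)].

Definition trace (w : jet) : cfun := xget (fun=> 0) [set g | is_trace B w g].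

Definition radial_derivative (w : cfun) (x : E) : R[i] :=
  \sum_i (x ord0 i / enorm x)%:C * cpartial i w x.

Definition sommerfeld (k : R) (w : cfun) : Prop :=
  forall e : R, 0 < e -> exists r0 : R, forall x : E, r0 <= enorm x ->
    (enorm x `^ ((d%:R - 1) / 2)) *
      cabs (radial_derivative w x - (0 +i* k) * w x) < e.

(* w = w_g: the radiating solution of the Helmholtz equation outside the closed
   ball with Dirichlet data g. The space of solutions is H^1_loc up to the
   sphere; in the open exterior they are classical by elliptic regularity. *)
Definition exterior_solution (k : R) (g w : cfun) : Prop :=
  [/\ cCk 2 (exterior rad) w,
      forall x, exterior rad x -> claplacian w x + (k ^+ 2)%:C * w x = 0,
      forall r, rad < r -> L2 (annulus rad r) w /\
        forall i, L2 (annulus rad r) (cpartial i w),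
      is_trace (annulus rad (2 * rad)) (jet_of w) g &
      sommerfeld k w].

(* F in H^{-1/2}(Gamma) is the normal derivative of w on the sphere, for the
   normal pointing away from the origin, defined through Green's formula
   in the exterior (whose outward normal is -nu). *)
Definition is_normal_derivative (k : R) (w : cfun) (F : cfun -> R[i]) : Prop :=
  antidual H12 normH12 F /\
  forall phi : cfun, ctest_function setT phi ->
    F phi = - cint (exterior rad) (fun x =>
      \sum_i cpartial i w x * conjc (cpartial i phi x)
      - (k ^+ 2)%:C * w x * conjc (phi x)).

(* <T_k g, h> = dtn k g h for g, h in H^{1/2}(Gamma). *)
Definition dtn (k : R) (g : cfun) : cfun -> R[i] :=
  xget (fun=> 0) [set F |
    exists w, exterior_solution k g w /\ is_normal_derivative k w F].

Definition helmholtz_form (k : R) (n : E -> R) (w xi : jet) : R[i] :=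
  cint B (fun x => \sum_i w.2 i x * conjc (xi.2 i x)
                   - (k ^+ 2 * n x)%:C * w.1 x * conjc (xi.1 x))
  - dtn k (trace w) (trace xi).

Definition plane_wave (k : R) (d0 : E) : cfun :=
  fun x => cos (k * dot d0 x) +i* sin (k * dot d0 x).

(* The functional xi |-> <d_nu u - T_k (gamma u), gamma xi> with u the plane
   wave; d_nu u is a smooth function on the sphere. *)
Definition incident_functional (k : R) (d0 : E) (xi : jet) : R[i] :=
  surface_int (fun x =>
    radial_derivative (plane_wave k d0) x * conjc (trace xi x))
  - dtn k (trace (jet_of (plane_wave k d0))) (trace xi).

Definition source1 (chi : E -> R) (u v xi : jet) : R[i] :=
  cint B (fun x => (chi x)%:C * conjc (u.1 x) * v.1 x * conjc (xi.1 x)).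
Definition source2 (chi : E -> R) (u eta : jet) : R[i] :=
  cint B (fun x => (chi x)%:C * (u.1 x) ^+ 2 * conjc (eta.1 x)).

(* Near each boundary point, D is the strict epigraph, in some unit direction e,
   of a Lipschitz function of the coordinates orthogonal to e (a function on R^d
   invariant in the direction e). *)
Definition bounded_lipschitz_domain (D : set E) : Prop :=
  [/\ open D, connected D, D !=set0, bounded_set D &
    forall x0 : E, (closure D `\` D) x0 ->
      exists (e : E) (r L : R) (f : E -> R),
        [/\ enorm e = 1, 0 < r,
            forall x y, `|f x - f y| <= L * enorm (x - y),
            forall x t, f (x + t *: e) = f x &
            forall x, enorm (x - x0) < r -> (D x <-> f x < dot x e)]].

Definition refractive_index (D : set E) (nmin nmax : R) (n : E -> R) : Prop :=
  [/\ measurable_fun B n,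
      {ae leb R d, forall x, B x -> nmin <= n x <= nmax} &
      {ae leb R d, forall x, B x -> ~ closure D x -> n x = 1}].

Definition susceptibility (D : set E) (chi : E -> R) : Prop :=
  [/\ Loo chi, {ae leb R d, forall x, 0 <= chi x} &
      {ae leb R d, forall x, ~ closure D x -> chi x = 0}].

Definition reference_simplex : set E :=
  [set x | (forall i, 0 <= x ord0 i) /\ \sum_i x ord0 i <= 1].

Definition barycentric (x : E) (i : 'I_d.+1) : R :=
  if unlift ord0 i is Some j then x ord0 j else 1 - \sum_j x ord0 j.

(* The face spanned by the vertices in S; it is empty for S = set0. *)
Definition face (S : {set 'I_d.+1}) : set E :=
  [set x | reference_simplex x /\
     forall i, i \notin S -> barycentric x i = 0].

(* A mesh is given by its number of elements and, for each element, a chart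
   from the reference simplex. *)
Record mesh := Mesh { msize : nat; chart : 'I_msize -> E -> E }.

Definition element (T : mesh) (K : 'I_(msize T)) : set E :=
  @chart T K @` reference_simplex.

Definition affine_on (A : set E) (f : E -> E) : Prop :=
  exists (M : 'M[R]_d) (b : E), forall x, A x -> f x = x *m M + b.

(* Conforming simplicial mesh of the closed ball; only the elements which meet
   the sphere in more than one point may be curved. *)
Definition conforming_mesh (T : mesh) : Prop :=
  [/\ forall K : 'I_(msize T),
        {within reference_simplex, continuous (@chart T K)} /\
        set_inj reference_simplex (@chart T K),
      \bigcup_(K in [set: 'I_(msize T)]) element K = [set x | enorm x <= rad],
      forall K K' : 'I_(msize T), K != K' ->
        exists S S' : {set 'I_d.+1},
          [/\ S != [set: 'I_d.+1]%SET, S' != [set: 'I_d.+1]%SET,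
              element K `&` element K' = @chart T K @` face S &
              element K `&` element K' = @chart T K' @` face S'] &
      forall K : 'I_(msize T),
        (forall x y, (element K `&` Gamma) x -> (element K `&` Gamma) y ->
           x = y) ->
        affine_on reference_simplex (@chart T K)].

(* The ratio of diameter to inradius is bounded uniformly. *)
Definition shape_regular (T : R -> mesh) : Prop :=
  exists c : R, forall h, 0 < h -> forall K : 'I_(msize (T h)),
    exists (x0 : E) (r : R),
      [/\ 0 < r, forall x, enorm (x - x0) <= r -> element K x &
          forall x y, element K x -> element K y -> enorm (x - y) <= c * r].

Definition polynomial_of_degree (p : nat) (f : cfun) : Prop :=
  exists c : {ffun 'I_d -> 'I_p.+1} -> R[i], forall x,
    f x = \sum_(a : {ffun 'I_d -> 'I_p.+1} | (\sum_i a i <= p)%N)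
            c a * (\prod_i x ord0 i ^+ a i)%:C.

(* On each element w is, almost everywhere, a polynomial of degree at most p in
   the coordinates of the reference simplex (equivalently, on an affine element,
   in the Cartesian coordinates). *)
Definition piecewise_polynomial (p : nat) (T : mesh) (w : jet) : Prop :=
  forall K : 'I_(msize T), exists f : cfun, polynomial_of_degree p f /\
    {ae leb R d, forall y, element K y ->
       forall x, reference_simplex x -> @chart T K x = y -> w.1 y = f x}.

(* W is a finite-dimensional subspace of H^1(B), saturated for equality in
   H^1(B), of piecewise polynomials. *)
Definition fe_space (p : nat) (T : mesh) (W : set jet) : Prop :=
  (exists (N : nat) (b : 'I_N -> jet), (forall i, H1 B (b i)) /\
     forall w, W w <-> H1 B w /\
       exists c : 'I_N -> R[i], eqH1 B w (\sum_i c i *: b i)) /\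
  (forall w, W w -> piecewise_polynomial p T w).

Definition dense_family (W : R -> set jet) : Prop :=
  forall v, H1 B v ->
    inf [set normH1 B (v - z) | z in W h] @[h --> 0^'+] --> (0 : R).

End sobolev.

Section nonlinear.
Context (R : realType) (d : nat) (rad : R).
Local Notation jet := (jet R d).

Definition nonlinear_solution (a1 a2 : jet -> jet -> R[i]) (l : jet -> R[i])
    (chi1 chi2 : 'rV[R]_d -> R) (W : set jet) (u1 u2 : jet) : Prop :=
  [/\ W u1, W u2,
      forall xi, W xi -> a1 u1 xi = source1 rad chi1 u1 u2 xi + l xi &
      forall eta, W eta -> a2 u2 eta = source2 rad chi2 u1 eta].

Definition ball2 (W : set jet) (r s : R) (u1 u2 : jet) : Prop :=
  [/\ W u1, W u2, normH1 (eball rad) u1 <= r & normH1 (eball rad) u2 <= s].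

Definition unique_pair (P : jet -> jet -> Prop) : Prop :=
  exists u1 u2, P u1 u2 /\ forall v1 v2, P v1 v2 ->
    eqH1 (eball rad) v1 u1 /\ eqH1 (eball rad) v2 u2.

End nonlinear.

Section constants.
Context (R : realType).
Implicit Types M C c r : R.

Definition alpha_ M1 C c1 r : R := M1 * C * c1 * r.
Definition beta_ M2 C c2 r : R := 2 * M2 * C * c2 * r.
Definition sigma_ M2 C c2 r : R := beta_ M2 C c2 r * r / 2.
Definition theta_ M1 M2 C c1 c2 r : R := M1 * C * c1 * sigma_ M2 C c2 r.
Definition q_ M1 M2 C c1 c2 r : R :=
  theta_ M1 M2 C c1 c2 r + alpha_ M1 C c1 r * beta_ M2 C c2 r.

End constants.

(* Main.v *)
Require Import Defs.
From HB Require Import structures.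
From mathcomp Require Import all_boot all_order all_algebra.
From mathcomp Require Import complex.
From mathcomp Require Import all_classical all_reals all_analysis.
From mathcomp Require Import measurable_realfun ess_sup_inf.
From mathcomp Require Import ring lra.
Set Implicit Arguments.
Unset Strict Implicit.
Unset Printing Implicit Defensive.
Import Order.TTheory GRing.Theory Num.Theory.
Import numFieldNormedType.Exports.
Local Open Scope classical_set_scope.
Local Open Scope ring_scope.

(** Solving the second equation for the second unknown leaves one equation for
    the first unknown [u].  If [S u] solves the second problem with source
    [chi2 u^2] and [G u] the first one with source [chi1 (conj u) (S u)] plus
    the incident functional, then the solutions are the pairs [(u, S u)] with
    [G u = u].  By the stability of the linear problems and the product estimate
    [L^4 * L^4 * L^2], on the ball of radius [rho] the map [S] has values of norm
    at most [sigma_rho] and is Lipschitz with constant [beta], so [G] maps the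
    ball into itself and is Lipschitz with constant [theta + alpha * beta], which
    is [q < 1].  Uniqueness is the same estimate applied to two solutions.

    The continuous and the discrete problem are the same problem posed on a
    subspace [W] of [H^1], with [W] all of [H^1] or the finite element space, and
    [coupled_problem_unique_solution] treats both at once.  The map [G] is defined
    on all of [H^1] with values in [W].  Its iterates form a Cauchy sequence,
    which converges in [H^1] to some [u] with [G u = u] up to a function of norm
    0; then [G u], an element of [W], solves the problem on [W].  So completeness
    matters for [H^1] only.

    Completeness of [H^1] ([H1_complete]) is the Riesz--Fischer argument for the
    real and imaginary parts of a function and of its weak derivatives
    ([sqint_complete]), followed by a passage to the limit in the identity that
    defines weak derivatives ([sqint_weak_limit]).  The latter needs test
    functions to be square integrable on the ball, hence continuous functions of
    row vectors to be measurable ([continuous_measurable_rV]) and balls to have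
    finite measure ([leb_eball_lty]).  The source terms are bounded with the
    Hoelder inequality of exponents 4, 4, 2 ([hoelder442]), and the difference of
    two of them splits into source terms, one factor of which is a difference of
    functions ([source1_lipschitz], [source2_lipschitz]). *)

(** * Complex modulus *)

Section cabs_theory.
Context (R : realType).
Implicit Types z w : R[i].

Lemma cabs_ge0 z : 0 <= cabs z.
Proof. by case: z => a b; exact: sqrtr_ge0. Qed.

Lemma cabs0 : cabs (0 : R[i]) = 0.
Proof. exact: ComplexField.Normc.normc0. Qed.

Lemma cabs0_eq0 z : cabs z = 0 -> z = 0.
Proof. exact: ComplexField.Normc.eq0_normc. Qed.

Lemma cabsM z w : cabs (z * w) = cabs z * cabs w.
Proof. exact: ComplexField.Normc.normcM. Qed.

Lemma cabsD z w : cabs (z + w) <= cabs z + cabs w.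
Proof. exact: le_normcD. Qed.

Lemma cabsN z : cabs (- z) = cabs z.
Proof. exact: normcN. Qed.

Lemma cabsJ z : cabs (conjc z) = cabs z.
Proof. by case: z => a b; rewrite /cabs /= sqrrN. Qed.

Lemma cabs_real (r : R) : cabs r%:C%C = `|r|.
Proof. by rewrite /cabs /= expr0n/= addr0 sqrtr_sqr. Qed.

Lemma sqr_cabs z : cabs z ^+ 2 = complex.Re z ^+ 2 + complex.Im z ^+ 2.
Proof. by case: z => a b; rewrite /cabs /= sqr_sqrtr// addr_ge0// sqr_ge0. Qed.

Lemma Re_le_cabs z : `|complex.Re z| <= cabs z.
Proof.
rewrite -(@ler_pXn2r _ 2)// ?nnegrE ?cabs_ge0// sqr_cabs real_normK ?num_real//.
by rewrite lerDl sqr_ge0.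
Qed.

Lemma Im_le_cabs z : `|complex.Im z| <= cabs z.
Proof.
rewrite -(@ler_pXn2r _ 2)// ?nnegrE ?cabs_ge0// sqr_cabs real_normK ?num_real//.
by rewrite lerDr sqr_ge0.
Qed.

End cabs_theory.

(** * Coupled problems in a complete seminormed space *)

Section seminormed_space.
Context (R : realType) (X : lmodType R[i]).

Definition linear_subspace (W : set X) : Prop :=
  W 0 /\ forall (c : R[i]) u v, W u -> W v -> W (c *: u + v).

Definition seminorm_on (V : set X) (N : X -> R) : Prop :=
  [/\ forall u, 0 <= N u,
      forall c u, V u -> N (c *: u) = cabs c * N u &
      forall u v, V u -> V v -> N (u + v) <= N u + N v].

(** Completeness, for the only sequences that a contraction produces. *)
Definition geometrically_complete (V : set X) (N : X -> R) : Prop :=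
  forall u : nat -> X, (forall n, V (u n)) ->
  forall C q : R, 0 <= q < 1 -> (forall n, N (u n.+1 - u n) <= C * q ^+ n) ->
  exists2 v, V v & N (u n - v) @[n --> \oo] --> (0 : R).

Section subspace_theory.
Context (W : set X) (sW : linear_subspace W).

Lemma subspaceB u v : W u -> W v -> W (u - v).
Proof. by case: sW => _ h uW vW; rewrite addrC -scaleN1r; exact: h. Qed.

Lemma subspaceZ c u : W u -> W (c *: u).
Proof. by case: sW => w0 h uW; rewrite -[_ *: _]addr0; exact: h. Qed.

Lemma subspaceD u v : W u -> W v -> W (u + v).
Proof. by case: sW => _ h uW vW; rewrite -[u]scale1r; exact: h. Qed.

End subspace_theory.

Section seminorm_theory.
Context (V : set X) (N : X -> R) (sV : linear_subspace V) (sN : seminorm_on V N).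

Lemma seminorm0 : N 0 = 0.
Proof.
by case: sN sV => _ h _ [V0 _]; have := h 0 0 V0; rewrite scale0r cabs0 mul0r.
Qed.

Lemma seminormBC u v : V u -> V v -> N (u - v) = N (v - u).
Proof.
move=> uV vV; case: sN => _ h _.
have := h (-1) (v - u) (subspaceB sV vV uV); rewrite scaleN1r opprB => ->.
by rewrite cabsN (_ : cabs 1 = 1) ?mul1r//; exact: ComplexField.Normc.normc1.
Qed.

Lemma seminorm_triangle v u w : V u -> V v -> V w ->
  N (u - w) <= N (u - v) + N (v - w).
Proof.
move=> uV vV wV; case: sN => _ _ h.
by rewrite -[u - w](subrKA v); apply: h; exact: subspaceB.
Qed.

Lemma seminorm_le u v : V u -> V v -> N u <= N (u - v) + N v.
Proof.
move=> uV vV; have V0 : V 0 by case: sV.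
by have := seminorm_triangle uV vV V0; rewrite !subr0.
Qed.

(** The limit is a fixed point only up to the kernel of the seminorm. *)
Lemma contraction_fixed_point (G : X -> X) (rho q : R) :
  geometrically_complete V N -> 0 <= rho -> 0 <= q < 1 ->
  (forall u, V u -> N u <= rho -> V (G u) /\ N (G u) <= rho) ->
  (forall u v, V u -> V v -> N u <= rho -> N v <= rho ->
     N (G u - G v) <= q * N (u - v)) ->
  exists u, [/\ V u, N u <= rho & N (G u - u) = 0].
Proof.
move=> cV rho0 q01 GV Gq; have [N0 _ _] := sN.
have [q0 q1] := andP q01.
pose u n := iter n G 0.
have uV n : V (u n) /\ N (u n) <= rho.
  by elim: n => [|n [un unr]]; [case: sV; rewrite /= seminorm0|exact: GV].
have uN n : N (u n.+1 - u n) <= N (u 1%N - u 0%N) * q ^+ n.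
  elim: n => [|n IH]; first by rewrite expr0 mulr1.
  have [? ?] := uV n; have [? ?] := uV n.+1.
  apply: (le_trans (Gq _ _ _ _ _ _)) => //.
  by rewrite exprS mulrCA ler_wpM2l.
have [v vV uv] := cV u (fun n => (uV n).1) _ q q01 uN.
have vr : N v <= rho.
  apply/ler_addgt0Pr => e e0; near (\oo) => n.
  have := @seminorm_le v (u n) vV (uV n).1; rewrite seminormBC//; last by have [] := uV n.
  have : N (u n - v) < e by near: n; exact: (cvgr_lt 0).
  by have := (uV n).2; lra.
exists v; split => //; apply/eqP; rewrite eq_le N0 andbT.
have [GvV _] := GV _ vV vr.
apply/ler_addgt0Pr => e e0; rewrite add0r.
have uvS : N (u n.+1 - v) @[n --> \oo] --> (0 : R).
  by move: uv; rewrite -(cvg_shiftS (fun n => N (u n - v))).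
have e3 : 0 < e / 3 by rewrite divr_gt0.
near (\oo) => n.
have h1 : N (u n - v) < e / 3 by near: n; exact: (cvgr_lt 0).
have h2 : N (u n.+1 - v) < e / 3.
  by near: n; exact: (cvgr_lt 0 uvS).
have [unV unr] := uV n; have [Vn1 _] := uV n.+1.
have := @seminorm_triangle (u n.+1) (G v) v GvV Vn1 vV.
have := Gq _ _ vV unV vr unr; rewrite -/(u n.+1) -[G (u n)]/(u n.+1).
rewrite [N (v - _)]seminormBC//.
have : q * N (u n - v) <= N (u n - v) by rewrite ler_piMl// ltW.
lra.
Unshelve. all: by end_near. Qed.

End seminorm_theory.

Section antidual_problems.
Context (V W : set X) (N : X -> R).
Hypotheses (sW : linear_subspace W) (WV : W `<=` V) (sV : linear_subspace V)
  (sN : seminorm_on V N).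

(** A supremum of reals is informative only for a nonempty set; here 0 belongs
    to the unit ball of [W]. *)
Lemma dual_norm_ub F (K : R) : 0 <= K ->
  (forall u, W u -> cabs (F u) <= K * N u) -> dual_norm W N F <= K.
Proof.
move=> K0 FK; apply: sup_le_ub.
  case: sW => W0 _; exists (cabs (F 0)), 0 => //; split=> //.
  by rewrite (seminorm0 sV sN).
move=> _ [u [uW uN] <-]; apply: (le_trans (FK _ uW)).
by rewrite ler_piMr.
Qed.

Lemma dual_norm_ge0 F : antidual W N F -> 0 <= dual_norm W N F.
Proof.
case=> _ [K FK]; case: sW => W0 _; apply: (@le_trans _ _ (cabs (F 0))).
  exact: cabs_ge0.
apply: ub_le_sup; last by exists 0 => //; split=> //; rewrite (seminorm0 sV sN).
exists `|K| => _ [u [uW uN] <-]; apply: (le_trans (FK _ uW)).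
have [N0 _ _] := sN.
apply: (@le_trans _ _ (`|K| * N u)); first by rewrite ler_wpM2r// ler_norm.
by rewrite ler_piMr.
Qed.

(** Rescale [u] to norm 1; if [u] has norm 0, continuity forces [F u = 0]. *)
Lemma dual_norm_bound F u : antidual W N F -> W u ->
  cabs (F u) <= dual_norm W N F * N u.
Proof.
case=> Fl [K FK] uW; have [N0 NZ _] := sN; case: (sW) => W0 _.
have := N0 u; rewrite le_eqVlt => /predU1P[Nu0|Nu0].
  by rewrite -Nu0 mulr0; have := FK _ uW; rewrite -Nu0 mulr0.
have F0 : F 0 = 0.
  by apply: cabs0_eq0; apply/le_anti; rewrite cabs_ge0 andbT;
    have := FK _ W0; rewrite (seminorm0 sV sN) mulr0.
have FZ c v : W v -> F (c *: v) = conjc c * F v.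
  by move=> vW; have := Fl c v 0 vW W0; rewrite addr0 F0 addr0.
rewrite -ler_pdivrMr//.
have cN : cabs ((N u)^-1)%:C%C = (N u)^-1 by rewrite cabs_real ger0_norm// invr_ge0.
apply: ub_le_sup.
  exists `|K| => _ [v [vW vN] <-]; apply: (le_trans (FK _ vW)).
  apply: (@le_trans _ _ (`|K| * N v)); first by rewrite ler_wpM2r// ler_norm.
  by rewrite ler_piMr.
exists (((N u)^-1)%:C%C *: u).
  by split; [exact: subspaceZ|rewrite NZ; [rewrite cN mulVf// gt_eqF|exact: WV]].
by rewrite FZ// cabsM cabsJ cN mulrC.
Qed.

(** By linearity the difference of the solutions solves the problem whose data
    are the difference of [F] and [F']. *)
Lemma stability_difference (a : X -> X -> R[i]) m (F F' : X -> R[i]) w w' K :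
  (forall (c : R[i]) u v phi, W u -> W v -> W phi ->
     a (c *: u + v) phi = c * a u phi + a v phi) ->
  stability_bound W N a m -> 0 <= m -> 0 <= K ->
  antidual W N F -> antidual W N F' -> W w -> W w' ->
  (forall phi, W phi -> a w phi = F phi) ->
  (forall phi, W phi -> a w' phi = F' phi) ->
  (forall phi, W phi -> cabs (F phi - F' phi) <= K * N phi) ->
  N (w - w') <= m * K.
Proof.
move=> al st m0 K0 [Fl _] [Fl' _] wW w'W wF wF' FF'.
have aFF' : antidual W N (fun phi => F phi - F' phi).
  split; last by exists K.
  by move=> c u v uW vW; rewrite Fl// Fl'//; ring.
apply: (@le_trans _ _ (m * dual_norm W N (fun phi => F phi - F' phi))).
  apply: st => //; first exact: subspaceB.
  move=> phi phiW; rewrite addrC -scaleN1r al// wF// wF'//; ring.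
by rewrite ler_wpM2l// dual_norm_ub.
Qed.

End antidual_problems.

Section coupled_problem.
Context (V W : set X) (N : X -> R) (eqW : X -> X -> Prop)
  (a1 a2 : X -> X -> R[i]) (l : X -> R[i])
  (S1 : X -> X -> X -> R[i]) (S2 : X -> X -> R[i]) (m1 m2 k1 k2 rho : R).
Hypotheses (sV : linear_subspace V) (sN : seminorm_on V N)
  (cV : geometrically_complete V N) (sW : linear_subspace W) (WV : W `<=` V).
Hypotheses
  (a1l : forall (c : R[i]) u v phi, W u -> W v -> W phi ->
     a1 (c *: u + v) phi = c * a1 u phi + a1 v phi)
  (a2l : forall (c : R[i]) u v phi, W u -> W v -> W phi ->
     a2 (c *: u + v) phi = c * a2 u phi + a2 v phi)
  (solv1 : uniquely_solvable W N eqW a1) (solv2 : uniquely_solvable W N eqW a2)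
  (stab1 : stability_bound W N a1 m1) (stab2 : stability_bound W N a2 m2)
  (m1_ge0 : 0 <= m1) (m2_ge0 : 0 <= m2) (k1_ge0 : 0 <= k1) (k2_ge0 : 0 <= k2).
Hypotheses (lV : antidual V N l)
  (S1V : forall u v, V u -> V v -> antidual V N (S1 u v))
  (S2V : forall u, V u -> antidual V N (S2 u))
  (S1_bound : forall u v phi, V u -> V v -> V phi ->
     cabs (S1 u v phi) <= k1 * N u * N v * N phi)
  (S2_bound : forall u phi, V u -> V phi ->
     cabs (S2 u phi) <= k2 * N u * N u * N phi)
  (S1_lip : forall u v u' v' phi, V u -> V v -> V u' -> V v' -> V phi ->
     cabs (S1 u v phi - S1 u' v' phi) <=
     k1 * (N (u - u') * N v + N u' * N (v - v')) * N phi)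
  (S2_lip : forall u u' phi, V u -> V u' -> V phi ->
     cabs (S2 u phi - S2 u' phi) <= k2 * (N (u - u') * (N u + N u')) * N phi).
Let sigma := m2 * k2 * rho ^+ 2.
Let q := m1 * k1 * (sigma + 2 * (m2 * k2 * rho) * rho).
Hypotheses (rho_ge0 : 0 <= rho)
  (rho_self : m1 * dual_norm V N l + m1 * k1 * sigma * rho <= rho)
  (q_lt1 : q < 1).

Let antiW F : antidual V N F -> antidual W N F.
Proof.
case=> Fl [K FK]; split; last by exists K => u /WV; exact: FK.
by move=> c u v /WV ? /WV; exact: Fl.
Qed.

Let N_ge0 u : 0 <= N u. Proof. by case: sN. Qed.

Let sigma_ge0 : 0 <= sigma.
Proof. by rewrite /sigma !mulr_ge0// sqr_ge0. Qed.

Let antiD F F' : antidual V N F -> antidual V N F' ->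
  antidual V N (fun phi => F phi + F' phi).
Proof.
move=> [Fl [K FK]] [Fl' [K' FK']]; split.
  by move=> c u v uV vV; rewrite Fl// Fl'//; ring.
exists (K + K') => u uV; rewrite mulrDl (le_trans (cabsD _ _))//.
by rewrite lerD// ?FK// FK'.
Qed.

Let anti0 : antidual W N (fun=> 0).
Proof.
split=> [c u v _ _|]; first by rewrite mulr0 addr0.
by exists 0 => u _; rewrite cabs0 mul0r.
Qed.

(* Comparison with 0, which solves the problem with zero data. *)
Let stability (a : X -> X -> R[i]) m F w K :
  (forall (c : R[i]) u v phi, W u -> W v -> W phi ->
     a (c *: u + v) phi = c * a u phi + a v phi) ->
  stability_bound W N a m -> 0 <= m -> 0 <= K -> antidual W N F -> W w ->
  (forall phi, W phi -> a w phi = F phi) ->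
  (forall phi, W phi -> cabs (F phi) <= K * N phi) -> N w <= m * K.
Proof.
move=> al st m0 K0 aF wW wF FK; have W0 : W 0 by case: sW.
rewrite -[w]subr0.
apply: (stability_difference sW sV sN al st m0 K0 aF anti0 wW W0 wF) => phi phiW.
  by have := al (-1) 0 0 phi W0 W0 phiW; rewrite scaler0 addr0 mulN1r addNr.
by rewrite subr0; exact: FK.
Qed.

Let bound2 u w : V u -> N u <= rho -> W w ->
  (forall phi, W phi -> a2 w phi = S2 u phi) -> N w <= sigma.
Proof.
move=> uV ur wW wS.
have := @stability _ _ _ w (k2 * N u * N u) a2l stab2 m2_ge0 _ (antiW (S2V uV)) wW wS.
move=> h; apply: (le_trans (h _ _)).
- by rewrite !mulr_ge0.
- by move=> phi /WV phiV; exact: S2_bound.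
- rewrite /sigma -!mulrA ler_wpM2l// ler_wpM2l// expr2.
  by rewrite ler_pM.
Qed.

Let lip2 u u' w w' : V u -> V u' -> N u <= rho -> N u' <= rho -> W w -> W w' ->
  (forall phi, W phi -> a2 w phi = S2 u phi) ->
  (forall phi, W phi -> a2 w' phi = S2 u' phi) ->
  N (w - w') <= 2 * (m2 * k2 * rho) * N (u - u').
Proof.
move=> uV u'V ur u'r wW w'W wS wS'.
have := @stability_difference _ _ _ sW sV sN _ _ _ _ w w'
  (k2 * (N (u - u') * (N u + N u'))) a2l stab2 m2_ge0 _ (antiW (S2V uV))
  (antiW (S2V u'V)) wW w'W wS wS'.
move=> h; apply: (le_trans (h _ _)).
- by rewrite !mulr_ge0// addr_ge0.
- by move=> phi /WV phiV; exact: S2_lip.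
- rewrite (_ : 2 * _ * _ = m2 * (k2 * (N (u - u') * (rho + rho)))); last ring.
  by rewrite ler_wpM2l// ler_wpM2l// ler_wpM2l// lerD.
Qed.

Let data1 u v phi : R[i] := S1 u v phi + l phi.

Let data1V u v : V u -> V v -> antidual V N (data1 u v).
Proof. by move=> uV vV; apply: antiD => //; exact: S1V. Qed.

Let bound1 u v w : V u -> V v -> N u <= rho -> N v <= sigma -> W w ->
  (forall phi, W phi -> a1 w phi = data1 u v phi) -> N w <= rho.
Proof.
move=> uV vV ur vs wW wS.
have := @stability _ _ _ w (k1 * sigma * rho + dual_norm V N l) a1l stab1 m1_ge0 _
  (antiW (data1V uV vV)) wW wS.
have l0 : 0 <= dual_norm V N l by exact: (dual_norm_ge0 sV sV sN).
move=> h; apply: (le_trans (h _ _)).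
- by rewrite addr_ge0// !mulr_ge0.
- move=> phi /WV phiV; rewrite mulrDl (le_trans (cabsD _ _))// lerD//.
    apply: (le_trans (S1_bound _ _ _)) => //.
    by rewrite ler_wpM2r// [leRHS]mulrAC ler_pM ?mulr_ge0// ler_wpM2l.
  exact: (dual_norm_bound sV (@subset_refl _ V) sV sN lV phiV).
- by apply: le_trans rho_self; rewrite mulrDr addrC !mulrA.
Qed.

(* The constant [q] adds the effect of the change of [u], at fixed [v], and that
   of the change of [v], which [lip2] bounds by the change of [u]. *)
Let lip1 u v u' v' w w' : V u -> V v -> V u' -> V v' -> N v <= sigma ->
  N u' <= rho -> N (v - v') <= 2 * (m2 * k2 * rho) * N (u - u') -> W w -> W w' ->
  (forall phi, W phi -> a1 w phi = data1 u v phi) ->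
  (forall phi, W phi -> a1 w' phi = data1 u' v' phi) ->
  N (w - w') <= q * N (u - u').
Proof.
move=> uV vV u'V v'V vs u'r vv' wW w'W wS wS'.
have := @stability_difference _ _ _ sW sV sN _ _ _ _ w w'
  (k1 * (N (u - u') * N v + N u' * N (v - v'))) a1l stab1 m1_ge0 _
  (antiW (data1V uV vV)) (antiW (data1V u'V v'V)) wW w'W wS wS'.
move=> h; apply: (le_trans (h _ _)).
- by rewrite mulr_ge0// addr_ge0// mulr_ge0.
- move=> phi /WV phiV; rewrite /data1 opprD addrACA subrr addr0.
  exact: S1_lip.
- rewrite (_ : q * _ = m1 * (k1 * (N (u - u') * sigma +
    rho * (2 * (m2 * k2 * rho) * N (u - u'))))); last by rewrite /q; ring.
  by rewrite ler_wpM2l// ler_wpM2l// lerD// ?ler_wpM2l// ler_pM.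
Qed.

(** Solving the second equation for the second unknown turns the coupled problem
    into a fixed point problem for the first one.  The iterates converge in
    [V]; the solution is the image of their limit, which lies in [W] even
    though completeness is known for [V] only. *)
Theorem coupled_problem_unique_solution : exists u1 u2,
  [/\ [/\ W u1, W u2, N u1 <= rho & N u2 <= sigma],
      (forall phi, W phi -> a1 u1 phi = S1 u1 u2 phi + l phi),
      (forall phi, W phi -> a2 u2 phi = S2 u1 phi) &
      forall v1 v2, W v1 -> W v2 -> N v1 <= rho -> N v2 <= sigma ->
        (forall phi, W phi -> a1 v1 phi = S1 v1 v2 phi + l phi) ->
        (forall phi, W phi -> a2 v2 phi = S2 v1 phi) ->
        N (v1 - u1) = 0 /\ N (v2 - u2) = 0].
Proof.
have q0 : 0 <= q.
  by rewrite /q !mulr_ge0// addr_ge0// !mulr_ge0.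
have /choice[T2 T2P] : forall u, exists w, V u ->
    W w /\ forall phi, W phi -> a2 w phi = S2 u phi.
  move=> u; have [uV|] := pselect (V u); last by exists 0.
  by have [w [wW wS _]] := solv2 (antiW (S2V uV)); exists w.
have T2W u : V u -> W (T2 u) by move=> /T2P[].
have T2V u : V u -> V (T2 u) by move=> /T2W /WV.
have /choice[T1 T1P] : forall u, exists w, V u ->
    W w /\ forall phi, W phi -> a1 w phi = data1 u (T2 u) phi.
  move=> u; have [uV|] := pselect (V u); last by exists 0.
  by have [w [wW wS _]] := solv1 (antiW (data1V uV (T2V _ uV))); exists w.
have T1W u : V u -> W (T1 u) by move=> /T1P[].
have T2s u : V u -> N u <= rho -> N (T2 u) <= sigma.
  by move=> uV ur; have [wW wS] := T2P _ uV; exact: (bound2 uV ur wW wS).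
have T1r u : V u -> N u <= rho -> N (T1 u) <= rho.
  move=> uV ur; have [wW wS] := T1P _ uV.
  by apply: (bound1 uV (T2V _ uV) ur _ wW wS); exact: T2s.
have T2lip u v : V u -> V v -> N u <= rho -> N v <= rho ->
    N (T2 u - T2 v) <= 2 * (m2 * k2 * rho) * N (u - v).
  move=> uV vV ur vr; have [? ?] := T2P _ uV; have [? ?] := T2P _ vV.
  exact: lip2.
have T1lip u v : V u -> V v -> N u <= rho -> N v <= rho ->
    N (T1 u - T1 v) <= q * N (u - v).
  move=> uV vV ur vr; have [? ?] := T1P _ uV; have [? ?] := T1P _ vV.
  apply: (@lip1 u (T2 u) v (T2 v)) => //;
    [exact: T2V|exact: T2V|exact: T2s|exact: T2lip].
have [u [uV ur Tu]] : exists u, [/\ V u, N u <= rho & N (T1 u - u) = 0].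
  apply: (contraction_fixed_point sV sN cV rho_ge0 _ _ T1lip).
    by rewrite q0.
  by move=> v vV vr; split; [exact/WV/T1W|exact: T1r].
have uT : N (u - T1 u) = 0 by rewrite (seminormBC sV sN)//; exact/WV/T1W.
have T1uV : V (T1 u) by exact/WV/T1W.
(* [T1 u] and [u] differ by an element of norm 0, which the sources ignore. *)
have eq1 phi : W phi -> a1 (T1 u) phi = S1 (T1 u) (T2 u) phi + l phi.
  move=> phiW; rewrite (T1P _ uV).2// /data1; congr (_ + _).
  apply/eqP; rewrite -subr_eq0; apply/eqP/cabs0_eq0/le_anti.
  rewrite cabs_ge0 andbT (le_trans (S1_lip _ _ _ _ _))//; try exact: T2V.
    exact: WV.
  by rewrite uT subrr (seminorm0 sV sN) mul0r mulr0 addr0 mulr0 mul0r.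
have eq2 phi : W phi -> a2 (T2 u) phi = S2 (T1 u) phi.
  move=> phiW; rewrite (T2P _ uV).2//.
  apply/eqP; rewrite -subr_eq0; apply/eqP/cabs0_eq0/le_anti.
  rewrite cabs_ge0 andbT (le_trans (S2_lip _ _ _))//; first exact: WV.
  by rewrite uT mul0r mulr0 mul0r.
exists (T1 u), (T2 u); split => //.
  by split; [exact: T1W|exact: T2W|exact: T1r|exact: T2s].
move=> v1 v2 v1W v2W v1r v2s eqv1 eqv2.
have v1V := WV v1W; have v2V := WV v2W.
have T1ur := T1r _ uV ur; have T2uV := T2V _ uV; have T1uW := T1W _ uV.
have h2 : N (v2 - T2 u) <= 2 * (m2 * k2 * rho) * N (v1 - T1 u).
  by apply: lip2 => //; exact: T2W.
have h1 : N (v1 - T1 u) <= q * N (v1 - T1 u).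
  exact: (@lip1 v1 v2 (T1 u) (T2 u)).
have v1T : N (v1 - T1 u) = 0.
  have : (1 - q) * N (v1 - T1 u) <= 0 by rewrite mulrBl mul1r subr_le0.
  rewrite pmulr_rle0 ?subr_gt0// => h0.
  by apply/le_anti; rewrite h0 N_ge0.
split=> //; apply/le_anti; rewrite N_ge0 andbT.
by move: h2; rewrite v1T mulr0.
Qed.

End coupled_problem.
End seminormed_space.

(** * Real square-integrable functions *)

Lemma geometric_cauchy_limit (R : realType) (a : nat -> R) (c t : R) :
  0 < t < 1 -> (forall n, `|a n.+1 - a n| <= c * t ^+ n) ->
  a @ \oo --> limn a /\ forall n, `|a n - limn a| <= c * t ^+ n / (1 - t).
Proof.
move=> /andP[t0 t1] ac.
have t10 : 0 < 1 - t by rewrite subr_gt0.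
have c0 : 0 <= c by have := le_trans (normr_ge0 _) (ac 0%N); rewrite expr0 mulr1.
have dist n k : `|a (n + k)%N - a n| <= c * t ^+ n / (1 - t) * (1 - t ^+ k).
  elim: k => [|k IH]; first by rewrite addn0 expr0 !subrr normr0 mulr0.
  rewrite addnS (_ : _ - _ = (a (n + k).+1 - a (n + k)%N) + (a (n + k)%N - a n)).
    apply: (le_trans (ler_normD _ _)); apply: (le_trans (lerD (ac _) IH)).
    rewrite le_eqVlt; apply/orP; left; apply/eqP.
    rewrite exprD exprS; field; exact: lt0r_neq0.
  by rewrite addrA subrK.
have dist' n k : `|a (n + k)%N - a n| <= c * t ^+ n / (1 - t).
  apply: (le_trans (dist n k)); rewrite ler_piMr//.
    by rewrite divr_ge0 ?mulr_ge0 ?exprn_ge0// ltW.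
  by rewrite gerBl exprn_ge0// ltW.
have cvga : cvgn a.
  have : cvgn (series (fun n => a n.+1 - a n)).
    apply: normed_cvg; apply: (@series_le_cvg _ _ (geometric c t)) => //.
    - by move=> n; exact: normr_ge0.
    - by move=> n; rewrite /= mulr_ge0// exprn_ge0// ltW.
    - by apply: is_cvg_geometric_series; rewrite gtr0_norm.
  move=> h; have -> : a = cst (a 0%N) + series (fun n => a n.+1 - a n).
    apply/funext => n; rewrite /series /=.
    by rewrite fctE telescope_sumr// addrC subrK.
  by apply: is_cvgD => //; exact: is_cvg_cst.
split=> // n; rewrite distrC.
have an : (fun k => `|a (k + n)%N - a n|) @ \oo --> `|limn a - a n|.
  apply: cvg_norm; apply: cvgB; last exact: cvg_cst.
  by rewrite (cvg_shiftn n a).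
rewrite -(cvg_lim _ an)//; apply: limr_le; first by apply/cvg_ex; eexists; exact: an.
by apply: nearW => k; rewrite addnC; exact: dist'.
Qed.

Section square_integrable.
Context d (T : measurableType d) (R : realType) (mu : {measure set T -> \bar R}).
Context (A : set T) (mA : measurable A).
Implicit Types f g : T -> R.

Definition sqint f : Prop :=
  measurable_fun A f /\ mu.-integrable A (EFin \o (fun x => f x ^+ 2)).

Lemma sqintP f : measurable_fun A f ->
  sqint f <-> (\int[mu]_(x in A) (f x ^+ 2)%:E < +oo)%E.
Proof.
move=> mf; split=> [[_ /integrableP[_]]|h].
  by under eq_integral do rewrite /= ger0_norm ?sqr_ge0//.
split=> //; apply/integrableP; split.
  by apply/measurable_EFinP; exact: measurable_funX.
by under eq_integral do rewrite /= ger0_norm ?sqr_ge0//.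
Qed.

Lemma sqint_le f (h : T -> R) : measurable_fun A f ->
  mu.-integrable A (EFin \o h) -> (forall x, A x -> f x ^+ 2 <= h x) -> sqint f.
Proof.
move=> mf ih fh; split=> //; apply: (le_integrable mA _ _ ih).
  by apply/measurable_EFinP; exact: measurable_funX.
move=> x Ax; rewrite /= lee_fin !ger0_norm ?sqr_ge0 ?fh//.
by rewrite (le_trans _ (fh _ Ax))// sqr_ge0.
Qed.

Lemma integrable_EFinD f g : mu.-integrable A (EFin \o f) ->
  mu.-integrable A (EFin \o g) -> mu.-integrable A (EFin \o (fun x => f x + g x)).
Proof. by move=> fi gi; apply: eq_integrable (integrableD mA fi gi). Qed.

Lemma integrable_EFinZ k f : mu.-integrable A (EFin \o f) ->
  mu.-integrable A (EFin \o (fun x => k * f x)).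
Proof. by move=> fi; apply: eq_integrable (integrableZl mA k fi). Qed.

Lemma sqint0 : sqint (fun=> 0).
Proof.
split=> //; apply: eq_integrable (integrable0 mu A) => // x _.
by rewrite /= expr0n.
Qed.

Lemma sqintD f g : sqint f -> sqint g -> sqint (fun x => f x + g x).
Proof.
move=> [mf fi] [mg gi]; apply: (@sqint_le _ (fun x => 2 * f x ^+ 2 + 2 * g x ^+ 2)).
- exact: measurable_funD.
- by apply: integrable_EFinD; exact: integrable_EFinZ.
- by move=> x _; have := sqr_ge0 (f x - g x); nra.
Qed.

Lemma sqintZ k f : sqint f -> sqint (fun x => k * f x).
Proof.
move=> [mf fi]; apply: (@sqint_le _ (fun x => k ^+ 2 * f x ^+ 2)).
- exact: measurable_funM.
- exact: integrable_EFinZ.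
- by move=> x _; rewrite exprMn.
Qed.

Lemma sqintB f g : sqint f -> sqint g -> sqint (fun x => f x - g x).
Proof.
move=> fi gi; rewrite (_ : (fun _ => _) = fun x => f x + (-1) * g x).
  by apply: sqintD => //; exact: sqintZ.
by apply/funext => x; rewrite mulN1r.
Qed.

Lemma sqint_mul f g : sqint f -> sqint g ->
  mu.-integrable A (EFin \o (fun x => f x * g x)).
Proof.
move=> [mf fi] [mg gi].
apply: (le_integrable mA _ _ (integrable_EFinD fi gi)).
  by apply/measurable_EFinP; exact: measurable_funM.
move=> x _; rewrite /= lee_fin [leRHS]ger0_norm ?addr_ge0 ?sqr_ge0// normrM.
rewrite -(real_normK (num_real (f x))) -(real_normK (num_real (g x))).
by have := sqr_ge0 (`|f x| - `|g x|); have := normr_ge0 (f x);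
  have := normr_ge0 (g x); nra.
Qed.

(** Cauchy--Schwarz in the form of Young's inequality with a free weight. *)
Lemma sqint_young f g e : 0 < e -> sqint f -> sqint g ->
  `|\int[mu]_(x in A) (f x * g x)| <=
  e^-1 * \int[mu]_(x in A) (f x ^+ 2) + e * \int[mu]_(x in A) (g x ^+ 2).
Proof.
move=> e0 fi gi; have fgi := sqint_mul fi gi.
apply: (le_trans (le_normr_Rintegral mA fgi)).
have [_ f2] := fi; have [_ g2] := gi.
rewrite -!RintegralZl// -RintegralD//; try exact: integrable_EFinZ.
apply: le_Rintegral => //.
- exact: integrable_norm.
- by apply: integrable_EFinD; exact: integrable_EFinZ.
- move=> x _; rewrite normrM.
  rewrite -(real_normK (num_real (f x))) -(real_normK (num_real (g x))).
  set a := `|f x|; set b := `|g x|.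
  have a0 : 0 <= a := normr_ge0 _; have b0 : 0 <= b := normr_ge0 _.
  have : 0 <= e^-1 * (a - e * b) ^+ 2 by rewrite mulr_ge0 ?invr_ge0 ?sqr_ge0// ltW.
  have -> : e^-1 * (a - e * b) ^+ 2 = e^-1 * a ^+ 2 + e * b ^+ 2 - 2 * (a * b).
    by field; exact: lt0r_neq0.
  have : 0 <= a * b by exact: mulr_ge0.
  lra.
Qed.

Lemma sqint_weak_limit (f : nat -> T -> R) g phi : (forall n, sqint (f n)) ->
  sqint g -> sqint phi ->
  (fun n => \int[mu]_(x in A) ((f n x - g x) ^+ 2)) @ \oo --> (0 : R) ->
  (fun n => \int[mu]_(x in A) (f n x * phi x)) @ \oo -->
    \int[mu]_(x in A) (g x * phi x).
Proof.
move=> fi gi phii fg; apply/cvgrPdist_lt => e e0.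
set P := \int[mu]_(x in A) (phi x ^+ 2).
have P0 : 0 <= P by apply: Rintegral_ge0 => x _; exact: sqr_ge0.
(* The weight that makes the second term of Young's inequality at most e / 2;
   the 1 covers the case [P = 0]. *)
pose s := e / 2 / (P + 1).
have P1 : 0 < P + 1 by rewrite ltr_wpDl.
have s0 : 0 < s by rewrite !divr_gt0.
near=> n; rewrite distrC.
have -> : \int[mu]_(x in A) (f n x * phi x) - \int[mu]_(x in A) (g x * phi x) =
    \int[mu]_(x in A) ((f n x - g x) * phi x).
  rewrite -RintegralB//; try exact: sqint_mul.
  by apply: eq_Rintegral => x _; rewrite mulrBl.
apply: (le_lt_trans (sqint_young s0 (sqintB (fi n) gi) phii)); rewrite -/P.
have h1 : \int[mu]_(x in A) ((f n x - g x) ^+ 2) < s * (e / 2).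
  by near: n; apply: (cvgr_lt 0) => //; rewrite mulr_gt0 ?divr_gt0.
have h2 : s * P <= e / 2.
  rewrite /s -mulrA ler_piMr//; first by rewrite ltW ?divr_gt0.
  by rewrite mulrC ler_pdivrMr// mul1r lerDl.
have : s^-1 * \int[mu]_(x in A) ((f n x - g x) ^+ 2) < e / 2.
  by rewrite mulrC ltr_pdivrMr// mulrC.
lra.
Unshelve. all: by end_near. Qed.

(** The squared increments divided by [(t ^+ n) ^+ 2] still have an integrable
    sum.  Where this sum is finite the sequence converges, with an error that the
    sum itself dominates, so the errors are integrated without any passage to the
    limit under the integral. *)
Lemma sqint_complete (f : nat -> T -> R) (C t : R) : 0 < t < 1 ->
  (forall n, sqint (f n)) ->
  (forall n, \int[mu]_(x in A) ((f n.+1 x - f n x) ^+ 2) <= C * (t ^+ n) ^+ 3) ->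
  exists g, sqint g /\ exists K, forall n,
    \int[mu]_(x in A) ((f n x - g x) ^+ 2) <= K * (t ^+ n) ^+ 2.
Proof.
move=> t01 fi fC; have [t0 t1] := andP t01.
have tn0 n : 0 < t ^+ n by rewrite exprn_gt0.
have t10 : 0 < 1 - t by rewrite subr_gt0.
pose H n x := ((f n.+1 x - f n x) ^+ 2 / (t ^+ n) ^+ 2)%:E.
have H0 n x : (0 <= H n x)%E by rewrite lee_fin divr_ge0// sqr_ge0.
have incr n : sqint (fun x => f n.+1 x - f n x) by exact: sqintB.
have mH n : measurable_fun A (H n).
  apply/measurable_EFinP; apply: measurable_funM => //.
  by apply: measurable_funX; have [] := incr n.
pose h (x : T) : \bar R := (\sum_(n <oo) H n x)%E.
have mh : measurable_fun A h by apply: ge0_emeasurable_sum.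
have C0 : 0 <= C.
  have := fC 0%N; rewrite expr0 expr1n mulr1; apply: le_trans.
  by apply: Rintegral_ge0 => x _; exact: sqr_ge0.
have IH n : (\int[mu]_(x in A) H n x <= (C * t ^+ n)%:E)%E.
  have [_ ii] := incr n.
  rewrite (_ : H n = fun x => ((t ^+ n) ^- 2)%:E * ((f n.+1 x - f n x) ^+ 2)%:E)%E.
    rewrite integralZl// -[X in (_ * X)%E]fineK; last exact: integrable_fin_num.
    rewrite -EFinM lee_fin mulrC ler_pdivrMr ?exprn_gt0//.
    by apply: (le_trans (fC n)); rewrite -mulrA -exprS.
  by apply/funext => x; rewrite /H mulrC EFinM.
have ih : (\int[mu]_(x in A) h x < +oo)%E.
  rewrite integral_nneseries//.
  apply: (@le_lt_trans _ _ (C / (1 - t))%:E); last exact: ltry.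
  apply: lime_le; first by apply: is_cvg_nneseries => n _ _; exact: integral_ge0.
  apply: nearW => n; apply: (@le_trans _ _ (\sum_(0 <= k < n) (C * t ^+ k)%:E)%E).
    by apply: lee_sum => k _; exact: IH.
  rewrite sumEFin lee_fin.
  have -> : \sum_(0 <= k < n) (C * t ^+ k) = C / (1 - t) * (1 - t ^+ n).
    elim: n => [|n IHn]; first by rewrite big_nil expr0 subrr mulr0.
    rewrite big_nat_recr//= IHn exprS; field; exact: lt0r_neq0.
  rewrite ler_piMr ?divr_ge0// ?(ltW t10)//.
  by rewrite gerBl ltW.
have h0 x : (0 <= h x)%E by exact: nneseries_ge0.
have hi : mu.-integrable A h.
  apply/integrableP; split=> //.
  by under eq_integral do rewrite gee0_abs//.
have [N [mN muN AN]] := integrable_ae mA hi.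
(* Cutting off the negligible set of divergence makes the sequence converge
   everywhere on [A], hence its limit measurable. *)
pose phi n x := f n x * \1_(~` N) x.
pose g x := limn (phi ^~ x).
have good x : A x -> ~ N x -> forall n,
    `|phi n.+1 x - phi n x| <= Num.sqrt (fine (h x)) * t ^+ n.
  move=> Ax Nx n; have hx : h x \is a fin_num.
    by apply: contrapT => hx; apply/Nx/AN => /(_ Ax).
  rewrite /phi indicE mem_set// !mulr1 -(@ler_pXn2r _ 2)// ?nnegrE ?mulr_ge0 ?(ltW (tn0 _))//.
  rewrite real_normK ?num_real// exprMn sqr_sqrtr ?fine_ge0//.
  rewrite -ler_pdivrMr ?exprn_gt0// -lee_fin fineK//.
  rewrite -/(H n x) /h (nneseries_split 0 n.+1)//= add0n big_nat_recr//=.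
  rewrite -[leLHS]add0e -[leLHS]adde0; apply: leeD; last exact: nneseries_ge0.
  by apply: leeD => //; apply: sume_ge0.
have bad y : N y -> (fun n => phi n y) = cst 0.
  by move=> Ny; apply/funext => n; rewrite /phi indicE memNset ?mulr0//; apply.
have cvg_phi y : A y -> (fun n => phi n y) @ \oo --> g y.
  move=> Ay; have [Ny|Ny] := pselect (N y).
    by rewrite /g bad// lim_cst//; exact: cvg_cst.
  by have [] := geometric_cauchy_limit t01 (good _ Ay Ny).
have mg : measurable_fun A g.
  apply: (@measurable_fun_cvg _ _ _ _ phi) => // n.
  apply: measurable_funM; first by have [] := fi n.
  by apply: measurable_funTS; apply: measurable_indic; exact: measurableC.
have main n : (\int[mu]_(x in A) ((f n x - g x) ^+ 2)%:E <=
    (((t ^+ n) / (1 - t)) ^+ 2)%:E * \int[mu]_(x in A) h x)%E.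
  rewrite -integralZl//; apply: ae_ge0_le_integral => //.
  - by move=> x _; rewrite lee_fin sqr_ge0.
  - apply/measurable_EFinP; apply: measurable_funX; apply: measurable_funB => //.
    by have [] := fi n.
  - by move=> x _; rewrite mule_ge0// lee_fin sqr_ge0.
  - by apply: emeasurable_funM.
  exists N; split=> // x /= /not_implyP[Ax hx]; apply: contrapT => Nx; apply: hx.
  have hfin : h x \is a fin_num.
    by apply: contrapT => hfin; apply/Nx/AN => /(_ Ax).
  rewrite -[h x]fineK// -EFinM lee_fin.
  have [_ /(_ n)] := geometric_cauchy_limit t01 (good _ Ax Nx).
  rewrite -/(g x) {1}/phi indicE mem_set// mulr1 => fg.
  rewrite -real_normK ?num_real//.
  rewrite -[fine _]sqr_sqrtr ?fine_ge0// -exprMn ler_pXn2r// ?nnegrE.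
  + by rewrite mulrC mulrA.
  + by rewrite mulr_ge0// divr_ge0// ltW.
have ifg n : sqint (fun x => f n x - g x).
  apply/sqintP; first by apply: measurable_funB => //; have [] := fi n.
  apply: (le_lt_trans (main n)).
  by rewrite lte_mul_pinfty// ?lee_fin ?sqr_ge0//.
exists g; split.
  rewrite (_ : g = fun x => f 0%N x - (f 0%N x - g x)); first exact: sqintB.
  by apply/funext => x; rewrite subKr.
exists ((1 - t) ^- 2 * fine (\int[mu]_(x in A) h x)%E) => n.
have [_ ii] := ifg n.
have hfin : (\int[mu]_(x in A) h x)%E \is a fin_num by exact: integrable_fin_num.
rewrite -lee_fin /Rintegral fineK; last exact: integrable_fin_num.
apply: (le_trans (main n)); rewrite -[X in (_ * X)%E]fineK// -EFinM lee_fin.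
by rewrite expr_div_n -mulrA [leRHS]mulrC.
Qed.

End square_integrable.

(** * Lebesgue measure on row vectors *)

Section row_vectors.
Context (R : realType) (d : nat).
Local Notation E := 'rV[R]_d.
Implicit Types (x : E) (f : E -> R).

Definition box (a : E) (r : R) : set E :=
  [set x | forall i, `|x ord0 i - a ord0 i| < r].

Lemma measurable_box a r : measurable (box a r).
Proof.
rewrite (_ : box a r = \bigcap_(i in [set: 'I_d])
    (rV_coord i @^-1` [set t | `|t - a ord0 i| < r])); last first.
  by apply/seteqP; split => x h i; [move=> _; exact: h|exact: (h i)].
apply: fin_bigcap_measurable => // i _.
rewrite -[_ @^-1` _]setTI; apply: measurable_rV_coord => //.
rewrite (_ : [set t | _] = `]a ord0 i - r, a ord0 i + r[%classic) //.
by apply/seteqP; split => t /=; rewrite in_itv/= ltr_distl.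
Qed.

(** Every open set is the union of the boxes with rational center and radius
    that it contains. *)
Lemma open_measurable_rV (U : set E) : open U -> measurable U.
Proof.
move=> oU; pose a (c : 'rV[rat]_d * rat) : E := \row_i ratr (c.1 ord0 i).
pose F c := if `[< box (a c) (ratr c.2) `<=` U >] then box (a c) (ratr c.2) else set0.
have -> : U = \bigcup_c F c.
  apply/seteqP; split => x; last first.
    by case=> c _; rewrite /F; case: asboolP => // h /h.
  move=> Ux; have /nbhs_ballP[e /= e0 xU] : nbhs x U by exact: open_nbhs_nbhs.
  have [q] := rat_in_itvoo (divr_gt0 e0 (ltr0n R 2)).
  rewrite in_itv/= => /andP[q0 qe].
  have /choice[c cx] : forall i : 'I_d, exists c : rat, `|x ord0 i - ratr c| < ratr q.
    move=> i; have [] := @rat_in_itvoo R (x ord0 i - ratr q) (x ord0 i + ratr q).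
      by rewrite ltrD2l gtrN.
    by move=> c; rewrite in_itv/= -ltr_distl distrC; exists c.
  exists (\row_i c i, q) => //; rewrite /F; case: asboolP => [_ i|nU].
    by rewrite !mxE; exact: cx.
  exfalso; apply: nU => y yb; apply: xU; split=> // i j; rewrite /ball /= ord1.
  have := yb j; rewrite !mxE => yc; have xc := cx j.
  rewrite -(subrKA (ratr (c j))).
  rewrite (le_lt_trans (ler_normD _ _))// [`|ratr _ - _|]distrC; lra.
apply: countable_bigcupT_measurable => // c.
by rewrite /F; case: asboolP => // _; exact: measurable_box.
Qed.

Lemma continuous_measurable_rV f : continuous f -> measurable_fun [set: E] f.
Proof.
move=> /continuousP cf; apply: (measurability _ (RGenOpens.measurableE R)) => //.
move=> _ [_ [a [b ->]] <-]; rewrite setTI; apply: open_measurable_rV.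
by apply: cf; exact: interval_open.
Qed.

Lemma measurable_enorm : measurable_fun [set: E] (@enorm R d).
Proof.
have mdot : measurable_fun [set: E] (fun x => dot x x).
  by apply: measurable_sum => i; apply: measurable_funM; exact: measurable_rV_coord.
have msqrt : measurable_fun [set: R] (@Num.sqrt R).
  by apply: continuous_measurable_fun; exact: sqrt_continuous.
exact: measurableT_comp msqrt mdot.
Qed.

Lemma measurable_eball r : measurable (eball r : set E).
Proof.
rewrite (_ : eball r = @enorm R d @^-1` `]-oo, r[%classic).
  by rewrite -[_ @^-1` _]setTI; exact: measurable_enorm.
by apply/seteqP; split => x; rewrite /eball /= in_itv.
Qed.

Lemma eball_box r : eball r `<=` box 0 r.
Proof.
move=> x xr i; rewrite mxE subr0; apply: le_lt_trans xr.
rewrite -sqrtr_sqr; apply: ler_wsqrtr.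
by rewrite /dot (bigD1 i)//= -expr2 lerDl sumr_ge0// => j _; rewrite -expr2 sqr_ge0.
Qed.

(** The ball lies in a compact cube. *)
Lemma continuous_bounded_eball f r : continuous f ->
  exists M, forall x, eball r x -> `|f x| <= M.
Proof.
move=> cf; pose K := [set x : E | forall i, `[- r, r]%classic (x ord0 i)].
have cK : compact K.
  apply: (@rV_compact _ _ (fun=> `[- r, r]%classic)) => _; exact: segment_compact.
have : compact (f @` K) by apply: continuous_compact => //; exact: continuous_subspaceT.
move=> /compact_bounded[M [_ MK]].
exists (M + 1) => x xr; apply: (MK (M + 1)); first by rewrite ltrDl.
exists x => // i; rewrite /= in_itv/= -ler_norml.
by have := eball_box xr i; rewrite mxE subr0 => /ltW.
Qed.

End row_vectors.

(** In dimension d + 1 a box is the product of a box and an interval, once the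
    last coordinate is split off as in the construction of the measure. *)
Lemma leb_box_lty (R : realType) d (a : 'rV[R]_d) r :
  (leb R d (box a r) < +oo)%E.
Proof.
elim: d => [|d IH] in a *.
  rewrite /= diracE; exact: ltry.
rewrite /= /rV_lebesgue_succ /pushforward.
pose b : 'rV[R]_d := \row_i a ord0 (lift ord_max i).
rewrite (_ : _ @^-1` _ = box b r `*` `]a ord0 ord_max - r, a ord0 ord_max + r[%classic).
  rewrite product_measure1E//; last exact: measurable_box.
  rewrite lte_mul_pinfty//; first by rewrite ge0_fin_numE.
  change (lebesgue_measure
    (`](a ord0 ord_max - r)%R, (a ord0 ord_max + r)%R[%classic : set R) < +oo)%E.
  by rewrite lebesgue_measure_itv/=; case: ifP => // _; rewrite -EFinB ltry.
apply/seteqP; split => [[p t] /= h|[p t] [/= ph th] i].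
  split => /=.
    by move=> i; have := h (lift ord_max i); rewrite !mxE liftK.
  by have := h ord_max; rewrite mxE unlift_none in_itv/= ltr_distl.
rewrite !mxE; case: unliftP => [j ->|->].
  by have := ph j; rewrite mxE.
by move: th; rewrite /= in_itv/= -ltr_distl.
Qed.

Lemma leb_eball_lty (R : realType) d (r : R) : (leb R d (eball r) < +oo)%E.
Proof.
apply: le_lt_trans (leb_box_lty 0 r); apply: le_measure; rewrite ?inE.
- exact: measurable_eball.
- exact: measurable_box.
- exact: eball_box.
Qed.

Lemma continuous_sqint (R : realType) d (f : 'rV[R]_d -> R) r :
  continuous f -> sqint (leb R d) (eball r) f.
Proof.
move=> cf; have [M fM] := continuous_bounded_eball r cf.
have mB : measurable (eball r : set 'rV[R]_d) by exact: measurable_eball.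
apply: (@sqint_le _ _ _ _ _ mB _ (cst (M ^+ 2))).
- by apply: measurable_funTS; exact: continuous_measurable_rV.
- apply: measurable_bounded_integrable => //; first exact: leb_eball_lty.
  exists `|M ^+ 2|; split; first exact: num_real.
  by move=> y My x _; exact: ltW.
- move=> x /fM fxM; rewrite -real_normK ?num_real//.
  by rewrite lerXn2r// nnegrE// (le_trans _ fxM).
Qed.

(** * The Sobolev space on a ball *)

Section real_factor.
Context (R : realType).
Implicit Types (z : R[i]) (r : R).

Lemma Re_mul_real z r : complex.Re (z * r%:C%C) = complex.Re z * r.
Proof. by case: z => a b /=; rewrite mulr0 subr0. Qed.

Lemma Im_mul_real z r : complex.Im (z * r%:C%C) = complex.Im z * r.
Proof. by case: z => a b /=; rewrite mulr0 add0r. Qed.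

End real_factor.

Section sobolev_ball.
Context (R : realType) (d : nat) (rad : R).
Local Notation E := 'rV[R]_d.
Local Notation jet := (jet R d).
Local Notation B := (eball rad : set E).
Local Notation mu := (leb R d).
Local Notation V := (@H1 R d B).
Local Notation N := (@normH1 R d B).
Implicit Types (u v w : jet) (x : E).

Let mB : measurable B := @measurable_eball R d rad.

(** A single index set for the function ([ord0]) and its weak derivatives (the
    lifted indices), in real and imaginary parts, makes the squared norm of [H^1]
    a finite sum of squared real [L^2] norms. *)
Definition component (k : 'I_d.+1 * bool) w x : R :=
  let g := if unlift ord0 k.1 is Some i then w.2 i else w.1 in
  if k.2 then complex.Re (g x) else complex.Im (g x).

(** The integrand of the squared norm. *)
Definition density w x : R := cabs (w.1 x) ^+ 2 + \sum_i cabs (w.2 i x) ^+ 2.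

Lemma component0 b w x : component (ord0, b) w x =
  if b then complex.Re (w.1 x) else complex.Im (w.1 x).
Proof. by rewrite /component /= unlift_none. Qed.

Lemma componentS i b w x : component (lift ord0 i, b) w x =
  if b then complex.Re (w.2 i x) else complex.Im (w.2 i x).
Proof. by rewrite /component /= liftK. Qed.

Lemma densityE w x : density w x = \sum_k component k w x ^+ 2.
Proof.
rewrite -(pair_bigA _ (fun k b => component (k, b) w x ^+ 2)) /=.
rewrite big_ord_recl big_bool !component0 /density sqr_cabs; congr (_ + _).
by apply: eq_bigr => i _; rewrite big_bool !componentS sqr_cabs.
Qed.

Lemma density_ge0 w x : 0 <= density w x.
Proof. by rewrite densityE sumr_ge0// => k _; exact: sqr_ge0. Qed.

Lemma normH1_ge0 w : 0 <= N w. Proof. exact: sqrtr_ge0. Qed.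

Lemma sqr_normH1 w : N w ^+ 2 = \int[mu]_(x in B) density w x.
Proof.
by rewrite /normH1 sqr_sqrtr// Rintegral_ge0// => x _; exact: density_ge0.
Qed.

Lemma component_linear k c u v x :
  component k (c *: u + v) x =
  complex.Re c * component k u x
  + (if k.2 then - complex.Im c else complex.Im c) * component (k.1, ~~ k.2) u x
  + component k v x.
Proof.
case: k => k b; rewrite /component /=.
have lin (z z' : R[i]) :
    (if b then complex.Re (c * z + z') else complex.Im (c * z + z')) =
    complex.Re c * (if b then complex.Re z else complex.Im z) +
    (if b then - complex.Im c else complex.Im c) *
      (if ~~ b then complex.Re z else complex.Im z) +
    (if b then complex.Re z' else complex.Im z').
  by case: c z z' b => [c1 c2] [z1 z2] [z1' z2'] [] /=; ring.
by case: unlift => [i|]; exact: lin.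
Qed.

Lemma componentB k u v x :
  component k (u - v) x = component k u x - component k v x.
Proof.
rewrite -[u - v]addrC -scaleN1r component_linear /=.
by case: k => k [] /=; ring.
Qed.

Lemma L2_sqint (g : cfun R d) : L2 B g <->
  sqint mu B (Refun g) /\ sqint mu B (Imfun g).
Proof.
have gE x : cabs (g x) ^+ 2 = Refun g x ^+ 2 + Imfun g x ^+ 2 by exact: sqr_cabs.
split=> [[mRe mIm]|[gRe gIm]].
  under eq_integral do rewrite gE.
  move=> gi; split; apply/sqintP => //; apply: le_lt_trans gi;
  apply: ge0_le_integral => //.
  - by move=> x _; rewrite lee_fin sqr_ge0.
  - by apply/measurable_EFinP; exact: measurable_funX.
  - by apply/measurable_EFinP; apply: measurable_funD; exact: measurable_funX.
  - by move=> x _; rewrite lee_fin lerDl sqr_ge0.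
  - by move=> x _; rewrite lee_fin sqr_ge0.
  - by apply/measurable_EFinP; exact: measurable_funX.
  - by apply/measurable_EFinP; apply: measurable_funD; exact: measurable_funX.
  - by move=> x _; rewrite lee_fin lerDr sqr_ge0.
have [mRe Rei] := gRe; have [mIm Imi] := gIm; split=> //.
under eq_integral do rewrite gE.
have /integrableP[_] := integrable_EFinD mB Rei Imi.
by under eq_integral do rewrite /= ger0_norm ?addr_ge0 ?sqr_ge0//.
Qed.

(** Test functions are real-valued, so the identity that defines weak derivatives
    holds for the real and the imaginary parts separately. *)
Lemma H1P w : V w <->
  (forall k, sqint mu B (component k w)) /\
  (forall (i : 'I_d) b (f : E -> R), test_function B f ->
     \int[mu]_(x in B) (component (ord0, b) w x * partial i f x) =
     - \int[mu]_(x in B) (component (lift ord0 i, b) w x * f x)).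
Proof.
have sq0 b : component (ord0, b) w = if b then Refun w.1 else Imfun w.1.
  by apply/funext => x; rewrite component0; case: b.
have sqS i b : component (lift ord0 i, b) w = if b then Refun (w.2 i) else Imfun (w.2 i).
  by apply/funext => x; rewrite componentS; case: b.
have cintE (g : cfun R d) (f : E -> R) : cint B (fun x => g x * (f x)%:C%C) =
    (\int[mu]_(x in B) (Refun g x * f x) +i* \int[mu]_(x in B) (Imfun g x * f x))%C.
  by rewrite /cint; congr Complex; apply: eq_Rintegral => x _;
    rewrite ?Re_mul_real ?Im_mul_real.
split=> [[/L2_sqint[w1 w1'] w2 wf]|[wk wf]]; split.
- move=> [k b]; have [i|] := unliftP ord0 k => ->.
    by rewrite sqS; have /L2_sqint[? ?] := w2 i; case: b.
  by rewrite sq0; case: b.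
- move=> i b f tf; have := wf i f tf; rewrite !cintE => -[eqRe eqIm].
  by rewrite sq0 sqS; case: b.
- by apply/L2_sqint; split; [have := wk (ord0, true)|have := wk (ord0, false)];
    rewrite sq0.
- by move=> i; apply/L2_sqint; split;
    [have := wk (lift ord0 i, true)|have := wk (lift ord0 i, false)]; rewrite sqS.
- move=> i f tf; rewrite !cintE.
  by have := wf i true f tf; have := wf i false f tf; rewrite !sq0 !sqS => -> ->.
Qed.

Lemma H1_component k w : V w -> sqint mu B (component k w).
Proof. by move=> /H1P[]. Qed.

Lemma test_function_sqint f i : test_function B f ->
  sqint mu B f /\ sqint mu B (partial i f).
Proof.
move=> [sf _]; split; apply: continuous_sqint => x.
  by have [] := sf 0%N [::] isT x I.
by have [] := sf 1%N [:: i] isT x I.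
Qed.

Lemma H1_subspace : linear_subspace V.
Proof.
split.
  apply/H1P; split=> [k|i b f tf].
    rewrite (_ : component k 0 = fun=> 0); first exact: sqint0.
    apply/funext => x; have := componentB k 0 0 x.
    by rewrite !subrr.
  have z k x : component k 0 x = 0 by have := componentB k 0 0 x; rewrite !subrr.
  under eq_Rintegral do rewrite z mul0r.
  under [X in _ = - X]eq_Rintegral do rewrite z mul0r.
  by rewrite /Rintegral integral0/= oppr0.
move=> c u v uV vV; have [uk uf] := (H1P u).1 uV; have [vk vf] := (H1P v).1 vV.
apply/H1P; split=> [k|i b f tf].
  rewrite (funext (component_linear k c u v)).
  by apply: (sqintD mB) => //; apply: (sqintD mB); exact: (sqintZ mB).
have [fi pfi] := test_function_sqint i tf.
have lin k g : sqint mu B g ->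
    \int[mu]_(x in B) (component k (c *: u + v) x * g x) =
    complex.Re c * \int[mu]_(x in B) (component k u x * g x) +
    (if k.2 then - complex.Im c else complex.Im c) *
      \int[mu]_(x in B) (component (k.1, ~~ k.2) u x * g x) +
    \int[mu]_(x in B) (component k v x * g x).
  move=> gi; set c' := if k.2 then _ else _.
  transitivity (\int[mu]_(x in B) (complex.Re c * (component k u x * g x) +
      c' * (component (k.1, ~~ k.2) u x * g x) + component k v x * g x)).
    by apply: eq_Rintegral => x _; rewrite component_linear -/c'; ring.
  have i1 := sqint_mul mB (uk k) gi.
  have i2 := sqint_mul mB (uk (k.1, ~~ k.2)) gi.
  rewrite RintegralD//; last exact: sqint_mul.
    rewrite RintegralD//; [|exact: integrable_EFinZ|exact: integrable_EFinZ].
    by rewrite !RintegralZl.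
  by apply: integrable_EFinD => //; exact: integrable_EFinZ.
rewrite !lin//= !uf// vf//; ring.
Qed.

Lemma density_integrable w : V w -> mu.-integrable B (EFin \o density w).
Proof.
move=> wV; rewrite (_ : _ \o _ = fun x => \sum_k (component k w x ^+ 2)%:E)%E.
  by apply: integrable_sum => // k; have [] := H1_component k wV.
by apply/funext => x; rewrite /= densityE sumEFin.
Qed.

Lemma sqr_normH1_sum w : V w ->
  N w ^+ 2 = \sum_k \int[mu]_(x in B) (component k w x ^+ 2).
Proof.
move=> wV; rewrite sqr_normH1 /Rintegral.
under eq_integral do rewrite densityE -sumEFin.
rewrite integral_sum//; last by move=> k; have [] := H1_component k wV.
rewrite -sum_fine// => k _; apply: integrable_fin_num => //.
by have [] := H1_component k wV.
Qed.

Lemma component_le_normH1 k w : V w ->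
  \int[mu]_(x in B) (component k w x ^+ 2) <= N w ^+ 2.
Proof.
move=> wV; rewrite sqr_normH1_sum// (bigD1 k)//= lerDl.
by apply: sumr_ge0 => j _; apply: Rintegral_ge0 => x _; exact: sqr_ge0.
Qed.

(** The triangle inequality comes from the pointwise bound
    [(a + b)^2 <= (1 + t) a^2 + (1 + 1/t) b^2], integrated and then optimized
    in [t]. *)
Lemma normH1_triangle u v : V u -> V v -> N (u + v) <= N u + N v.
Proof.
move=> uV vV.
have young t : 0 < t ->
    N (u + v) ^+ 2 <= (1 + t) * N u ^+ 2 + (1 + t^-1) * N v ^+ 2.
  move=> t0; rewrite !sqr_normH1.
  have ui := density_integrable uV; have vi := density_integrable vV.
  have uvi := density_integrable (subspaceD H1_subspace uV vV).
  rewrite -!RintegralZl// -RintegralD//; try exact: integrable_EFinZ.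
  apply: le_Rintegral => //.
    by apply: integrable_EFinD => //; exact: integrable_EFinZ.
  move=> x _.
  have pw (a b : R[i]) :
      cabs (a + b) ^+ 2 <= (1 + t) * cabs a ^+ 2 + (1 + t^-1) * cabs b ^+ 2.
    have := cabsD a b; have := cabs_ge0 (a + b); have := cabs_ge0 a.
    have := cabs_ge0 b; move: (cabs a) (cabs b) (cabs (a + b)) => p q r q0 p0 r0 rpq.
    apply: (@le_trans _ _ ((p + q) ^+ 2)); first by rewrite lerXn2r// nnegrE// addr_ge0.
    rewrite -subr_ge0.
    have -> : (1 + t) * p ^+ 2 + (1 + t^-1) * q ^+ 2 - (p + q) ^+ 2 =
        t^-1 * (t * p - q) ^+ 2 by field; exact: lt0r_neq0.
    by rewrite mulr_ge0 ?sqr_ge0// invr_ge0 ltW.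
  rewrite /density !mulrDr addrACA lerD//; first exact: pw.
  by rewrite !mulr_sumr -big_split/=; apply: ler_sum => i _; exact: pw.
have := normH1_ge0 u; have := normH1_ge0 v; have := normH1_ge0 (u + v).
move: (N u) (N v) (N (u + v)) young => a b c young c0 b0 a0.
(* The optimal weight is [t = b / a]; enlarging [a] and [b] makes it
   well-defined and positive. *)
suff pos a' b' : a <= a' -> b <= b' -> 0 < a' -> 0 < b' -> c <= a' + b'.
  apply/ler_addgt0Pr => e e0.
  rewrite (_ : a + b + e = (a + e / 2) + (b + e / 2)); last by field.
  have e2 : 0 < e / 2 by rewrite divr_gt0.
  by apply: pos; rewrite ?lerDl ?(ltW e2)// ltr_wpDl.
move=> aa' bb' a'0 b'0.
rewrite -(@ler_pXn2r _ 2)// ?nnegrE// ?addr_ge0 ?(ltW a'0) ?(ltW b'0)//.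
have := young (b' / a') (divr_gt0 b'0 a'0); rewrite invf_div => /le_trans; apply.
rewrite (_ : (a' + b') ^+ 2 =
    (1 + b' / a') * a' ^+ 2 + (1 + a' / b') * b' ^+ 2); last first.
  by field; rewrite !lt0r_neq0.
rewrite lerD// ler_wpM2l// ?addr_ge0 ?divr_ge0 ?(ltW a'0) ?(ltW b'0)//;
  by rewrite lerXn2r// nnegrE// ltW.
Qed.

Lemma normH1_seminorm : seminorm_on V N.
Proof.
split; [exact: normH1_ge0| |exact: normH1_triangle].
move=> c u uV; apply/eqP; rewrite -(@eqrXn2 _ 2)// ?mulr_ge0 ?cabs_ge0 ?normH1_ge0//.
rewrite exprMn !sqr_normH1 -RintegralZl//; last exact: density_integrable.
apply/eqP; apply: eq_Rintegral => x _; rewrite /density mulrDr mulr_sumr.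
rewrite -exprMn -cabsM; congr (_ + _).
by apply: eq_bigr => i _; rewrite -exprMn -cabsM.
Qed.

Lemma normH1_eq0 u v : V u -> V v -> N (u - v) = 0 -> eqH1 B u v.
Proof.
move=> uV vV uv0; have uvV := subspaceB H1_subspace uV vV.
have di := density_integrable uvV.
have : (\int[mu]_(x in B) `|(density (u - v) x)%:E| = 0)%E.
  under eq_integral do rewrite gee0_abs ?lee_fin ?density_ge0//.
  rewrite -[LHS]fineK; last exact: integrable_fin_num.
  by rewrite -[fine _]/(\int[mu]_(x in B) density (u - v) x) -sqr_normH1 uv0 expr0n.
move/(ae_eq_integral_abs mu mB (measurable_int mu di)).1.
apply: filterS => x /= h /h [] h0.
apply/eqP; rewrite -subr_eq0; apply/eqP/cabs0_eq0/eqP.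
rewrite -sqrf_eq0 eq_le sqr_ge0 andbT -[leRHS]h0 /density lerDl.
by apply: sumr_ge0 => i _; exact: sqr_ge0.
Qed.

Lemma H1_complete : geometrically_complete V N.
Proof.
move=> u uV C q /andP[q0 q1] uC.
pose t := (1 + q) / 2.
have t0 : 0 < t by rewrite divr_gt0// ltr_wpDr.
have t1 : t < 1 by rewrite ltr_pdivrMr// mul1r; lra.
(* [sqint_complete] asks the squared increments to be of order [t ^+ (3 * n)];
   here they are of order [q ^+ (2 * n)], and [q <= t ^+ 2] since the arithmetic
   mean of 1 and [q] exceeds the geometric one. *)
have qt : q ^+ 2 <= t ^+ 3.
  have qt2 : q <= t ^+ 2 by rewrite /t; nra.
  apply: (@le_trans _ _ (t ^+ 4)).
    by rewrite (_ : 4 = 2 * 2)%N// exprM lerXn2r// nnegrE// sqr_ge0.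
  by rewrite exprS ler_piMl ?exprn_ge0// ltW.
have incr k n : \int[mu]_(x in B) ((component k (u n.+1) x - component k (u n) x) ^+ 2)
    <= C ^+ 2 * (t ^+ n) ^+ 3.
  have dV : V (u n.+1 - u n) by exact: (subspaceB H1_subspace).
  have := component_le_normH1 k dV.
  under eq_Rintegral do rewrite componentB.
  move=> /le_trans; apply; apply: (@le_trans _ _ ((C * q ^+ n) ^+ 2)).
    by rewrite lerXn2r// nnegrE ?normH1_ge0// (le_trans (normH1_ge0 _) (uC n)).
  rewrite exprMn ler_wpM2l ?sqr_ge0// -!exprM ![(n * _)%N]mulnC !exprM.
  by rewrite lerXn2r// nnegrE ?exprn_ge0// ltW.
have /choice[g gP] : forall k, exists g, sqint mu B g /\ exists K, forall n,
    \int[mu]_(x in B) ((component k (u n) x - g x) ^+ 2) <= K * (t ^+ n) ^+ 2.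
  move=> k; apply: (@sqint_complete _ _ _ _ _ mB _ (C ^+ 2)) => //.
    by rewrite t0.
  by move=> n; exact: H1_component.
have /choice[K KP] : forall k, exists K, forall n,
    \int[mu]_(x in B) ((component k (u n) x - g k x) ^+ 2) <= K * (t ^+ n) ^+ 2.
  by move=> k; have [] := gP k.
pose v : jet := ((fun x => g (ord0, true) x +i* g (ord0, false) x)%C,
  (fun i x => g (lift ord0 i, true) x +i* g (lift ord0 i, false) x)%C).
have vg k : component k v = g k.
  apply/funext => x; case: k => k b; have [i|] := unliftP ord0 k => ->.
    by rewrite componentS; case: b.
  by rewrite component0; case: b.
have tcvg : (fun n => t ^+ n) @ \oo --> (0 : R).
  by apply: cvg_expr; rewrite gtr0_norm.
have kcvg k : (fun n => \int[mu]_(x in B)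
    ((component k (u n) x - g k x) ^+ 2)) @ \oo --> (0 : R).
  apply: (@squeeze_cvgr _ _ _ _ (cst 0) (fun n => K k * (t ^+ n) ^+ 2)).
  - apply: nearW => n; rewrite KP andbT.
    by apply: Rintegral_ge0 => x _; exact: sqr_ge0.
  - exact: cvg_cst.
  - rewrite -[X in _ --> X](mulr0 (K k)); apply: cvgM; first exact: cvg_cst.
    rewrite -[X in _ --> X](mulr0 0); under eq_fun do rewrite expr2.
    exact: cvgM.
have vV : V v.
  apply/H1P; split=> [k|i b f tf]; first by rewrite vg; have [] := gP k.
  have [fi pfi] := test_function_sqint i tf.
  rewrite !vg.
  have lim k phi : sqint mu B phi ->
      (fun n => \int[mu]_(x in B) (component k (u n) x * phi x)) @ \oo -->
      \int[mu]_(x in B) (g k x * phi x).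
    move=> phii; apply: (sqint_weak_limit mB _ _ phii (kcvg k)).
      by move=> n; exact: H1_component.
    by have [] := gP k.
  apply: (cvg_unique _ (lim (ord0, b) _ pfi)) => //.
  have -> : (fun n => \int[mu]_(x in B) (component (ord0, b) (u n) x * partial i f x)) =
      (fun n => - \int[mu]_(x in B) (component (lift ord0 i, b) (u n) x * f x)).
    by apply/funext => n; have [_ ->] := (H1P (u n)).1 (uV n).
  by apply: cvgN; exact: lim.
exists v => //.
pose S := \sum_k K k.
have bound n : N (u n - v) <= Num.sqrt S * t ^+ n.
  have tn0 : 0 < t ^+ n by rewrite exprn_gt0.
  rewrite -(ger0_norm (normH1_ge0 _)) -(ger0_norm (ltW tn0)) -!sqrtr_sqr.
  have NS : N (u n - v) ^+ 2 <= S * (t ^+ n) ^+ 2.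
    rewrite sqr_normH1_sum; last exact: (subspaceB H1_subspace).
    rewrite mulr_suml; apply: ler_sum => k _; apply: le_trans (KP k n).
    by under eq_Rintegral do rewrite componentB vg.
  rewrite -sqrtrM; first by exact: ler_wsqrtr.
  have := le_trans (sqr_ge0 _) NS; rewrite pmulr_lge0// exprn_gt0//.
apply: (@squeeze_cvgr _ _ _ _ (cst 0) (fun n => Num.sqrt S * t ^+ n)).
- by apply: nearW => n; rewrite normH1_ge0 bound.
- exact: cvg_cst.
- rewrite -[X in _ --> X](mulr0 (Num.sqrt S)).
  by apply: cvgM => //; exact: cvg_cst.
Qed.

Lemma fe_space_sub p T (W : set jet) : fe_space rad p T W -> W `<=` V.
Proof. by move=> [[n [b [_ Wb]]] _] w /Wb[]. Qed.

Lemma fe_space_subspace p T (W : set jet) : fe_space rad p T W -> linear_subspace W.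
Proof.
move=> [[n [b [_ Wb]]] _]; have [V0 VD] := H1_subspace; split.
  apply/Wb; split=> //; exists (fun=> 0).
  by rewrite big1 => [|i _]; [apply: nearW => x _|rewrite scale0r].
move=> c u v /Wb[uV [cu ucu]] /Wb[vV [cv vcv]].
apply/Wb; split; first exact: VD.
exists (fun i => c * cu i + cv i).
have -> : \sum_i (c * cu i + cv i) *: b i =
    c *: (\sum_i cu i *: b i) + \sum_i cv i *: b i.
  rewrite scaler_sumr -big_split/=; apply: eq_bigr => i _.
  by rewrite scalerDl scalerA.
apply: filterS2 ucu vcv => x /= ux vx Bx.
have := ux Bx; have := vx Bx => vx' ux'.
rewrite -[LHS]/(c * u.1 x + v.1 x) ux' vx' //.
Qed.

End sobolev_ball.

(** * Integrals of complex functions *)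

Section complex_integral.
Context (R : realType) (d : nat).
Local Notation E := 'rV[R]_d.
Local Notation mu := (leb R d).
Context (A : set E) (mA : measurable A).
Implicit Types (F G : E -> R[i]) (x : E).

Definition cmeasurable F : Prop :=
  measurable_fun A (@complex.Re R \o F) /\ measurable_fun A (@complex.Im R \o F).

Definition cintegrable F : Prop :=
  mu.-integrable A (EFin \o (@complex.Re R \o F)) /\
  mu.-integrable A (EFin \o (@complex.Im R \o F)).

Lemma cmeasurableM F G : cmeasurable F -> cmeasurable G ->
  cmeasurable (fun x => F x * G x).
Proof.
move=> [Fr Fi] [Gr Gi]; split.
  rewrite (_ : _ \o _ = fun x => complex.Re (F x) * complex.Re (G x) -
    complex.Im (F x) * complex.Im (G x)).
    by apply: measurable_funB; apply: measurable_funM.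
  by apply/funext => x /=; case: (F x) (G x) => [a b] [a' b'].
rewrite (_ : _ \o _ = fun x => complex.Re (F x) * complex.Im (G x) +
  complex.Im (F x) * complex.Re (G x)).
  by apply: measurable_funD; apply: measurable_funM.
by apply/funext => x /=; case: (F x) (G x) => [a b] [a' b'].
Qed.

Lemma cmeasurableJ F : cmeasurable F -> cmeasurable (fun x => conjc (F x)).
Proof.
move=> [Fr Fi]; split.
  rewrite (_ : _ \o _ = @complex.Re R \o F)//.
  by apply/funext => x /=; case: (F x).
rewrite (_ : _ \o _ = \- (@complex.Im R \o F)); last first.
  by apply/funext => x /=; case: (F x).
exact: measurableT_comp.
Qed.

Lemma cmeasurable_real (f : E -> R) : measurable_fun A f ->
  cmeasurable (fun x => (f x)%:C%C).
Proof. by move=> mf; split => //; exact: measurable_cst. Qed.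

Lemma cintD F G : cintegrable F -> cintegrable G ->
  cint A (fun x => F x + G x) = cint A F + cint A G.
Proof.
move=> [Fr Fi] [Gr Gi]; rewrite /cint.
have -> : (\int[mu]_(x in A) complex.Re (F x + G x) =
    \int[mu]_(x in A) complex.Re (F x) + \int[mu]_(x in A) complex.Re (G x)).
  rewrite -RintegralD//; apply: eq_Rintegral => x _.
  by case: (F x) (G x) => [a b] [a' b'].
have -> : (\int[mu]_(x in A) complex.Im (F x + G x) =
    \int[mu]_(x in A) complex.Im (F x) + \int[mu]_(x in A) complex.Im (G x)).
  rewrite -RintegralD//; apply: eq_Rintegral => x _.
  by case: (F x) (G x) => [a b] [a' b'].
by [].
Qed.

Lemma cintZ (c : R[i]) F : cintegrable F ->
  cint A (fun x => c * F x) = c * cint A F.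
Proof.
move=> [Fr Fi]; rewrite /cint; case: c => a b.
have -> : (\int[mu]_(x in A) complex.Re ((a +i* b)%C * F x) =
    a * \int[mu]_(x in A) complex.Re (F x) - b * \int[mu]_(x in A) complex.Im (F x)).
  rewrite -!RintegralZl// -RintegralB//; try exact: integrable_EFinZ.
  by apply: eq_Rintegral => x _; case: (F x) => [a' b'].
have -> : (\int[mu]_(x in A) complex.Im ((a +i* b)%C * F x) =
    a * \int[mu]_(x in A) complex.Im (F x) + b * \int[mu]_(x in A) complex.Re (F x)).
  rewrite -!RintegralZl// -RintegralD//; try exact: integrable_EFinZ.
  by apply: eq_Rintegral => x _; case: (F x) => [a' b'].
by [].
Qed.

Lemma cintegrable_le F (g : E -> R) : cmeasurable F ->
  mu.-integrable A (EFin \o g) -> (forall x, A x -> cabs (F x) <= g x) ->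
  cintegrable F.
Proof.
move=> [Fr Fi] gi Fg.
have le_g (h : E -> R) : measurable_fun A h -> (forall x, `|h x| <= cabs (F x)) ->
    mu.-integrable A (EFin \o h).
  move=> mh hF; apply: (le_integrable mA _ _ gi); first exact/measurable_EFinP.
  move=> x Ax; rewrite /= lee_fin (le_trans (hF x))//.
  by rewrite (le_trans (Fg x Ax))// ler_norm.
by split; apply: le_g => // x; [exact: Re_le_cabs|exact: Im_le_cabs].
Qed.

(** Rotating the integral onto the positive real axis turns its modulus into
    the integral of a real part. *)
Lemma cabs_cint_le F (g : E -> R) : cmeasurable F ->
  mu.-integrable A (EFin \o g) -> (forall x, A x -> cabs (F x) <= g x) ->
  cabs (cint A F) <= \int[mu]_(x in A) g x.
Proof.
move=> mF gi Fg; have Fi := cintegrable_le mF gi Fg.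
set z := cint A F; have := cabs_ge0 z; rewrite le_eqVlt => /predU1P[<-|z0].
  by apply: Rintegral_ge0 => x /Fg; apply: le_trans; exact: cabs_ge0.
rewrite -(ler_pM2l z0) -expr2 sqr_cabs.
have -> : complex.Re z ^+ 2 + complex.Im z ^+ 2 = complex.Re (conjc z * z).
  by case: (z) => a b /=; ring.
have [zFr zFi] : cintegrable (fun x => conjc z * F x).
  apply: (@cintegrable_le _ (fun x => cabs z * g x)).
  - apply: cmeasurableM => //; apply: cmeasurableJ.
    by split; exact: measurable_cst.
  - exact: integrable_EFinZ.
  - by move=> x Ax; rewrite cabsM cabsJ ler_wpM2l ?cabs_ge0// Fg.
rewrite -cintZ// -[complex.Re _]/(\int[mu]_(x in A) complex.Re (conjc z * F x)).
rewrite -RintegralZl//; apply: le_Rintegral => //.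
  exact: integrable_EFinZ.
move=> x Ax; apply: (le_trans (ler_norm _)); apply: (le_trans (Re_le_cabs _)).
by rewrite cabsM cabsJ ler_wpM2l ?cabs_ge0// Fg.
Qed.

End complex_integral.

(** * The quadratic source terms *)

Section hoelder_three.
Context d (T : measurableType d) (R : realType) (mu : {measure set T -> \bar R}).
Local Open Scope ereal_scope.
Local Notation "'N_ p [ f ]" := (Lnorm mu p (EFin \o f)).
Implicit Types f g h : T -> R.

Lemma Lnorm4E f : 'N_4%:E[f] = ('N_2%:E[(f \* f)%R]) `^ (2^-1).
Proof.
rewrite !unlock -poweRrM -invfM.
rewrite (_ : 2 * 2 = 4 :> R)%R; last by rewrite -natrM.
congr (_ `^ _); apply: eq_integral => x _ /=.
by rewrite normrM !powR_mulrn ?mulr_ge0 ?normr_ge0//; congr (_%:E); ring.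
Qed.

(** Hoelder's inequality with exponents 2, 2 for the squares. *)
Lemma Lnorm2M_le f g : measurable_fun setT f -> measurable_fun setT g ->
  'N_2%:E[(f \* g)%R] <= 'N_4%:E[f] * 'N_4%:E[g].
Proof.
move=> mf mg; rewrite !Lnorm4E -poweRM ?Lnorm_ge0//.
have sqrt_homo (x y : \bar R) : 0 <= x -> 0 <= y -> x <= y ->
    x `^ 2^-1 <= y `^ 2^-1.
  by move=> x0 y0; apply: gt0_ler_poweR; rewrite ?invr_ge0// in_itv/= ?x0 ?y0 leey.
rewrite {1}unlock; apply: sqrt_homo.
- by apply: integral_ge0 => x _; rewrite poweR_ge0.
- by rewrite mule_ge0// Lnorm_ge0.
apply: le_trans (hoelder mu _ _ _ _ _);
  [|exact: measurable_funM|exact: measurable_funM|by []|by []|].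
  rewrite Lnorm1 le_eqVlt; apply/orP; left; apply/eqP; apply: eq_integral => x _ /=.
  by rewrite powR_mulrn ?normr_ge0//; congr (_%:E); rewrite -normrX; congr `|_|%R; ring.
by rewrite [RHS](splitr 1) !div1r.
Qed.

Lemma hoelder442 f g h : measurable_fun setT f -> measurable_fun setT g ->
  measurable_fun setT h ->
  'N_1[(f \* g \* h)%R] <= 'N_4%:E[f] * 'N_4%:E[g] * 'N_2%:E[h].
Proof.
move=> mf mg mh.
apply: (@le_trans _ _ ('N_2%:E[(f \* g)%R] * 'N_2%:E[h])).
  apply: hoelder => //; first exact: measurable_funM.
  by rewrite [RHS](splitr 1) !div1r.
by rewrite lee_wpmul2r ?Lnorm_ge0// Lnorm2M_le.
Qed.

End hoelder_three.

Section source_terms.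
Context (R : realType) (d : nat) (rad : R).
Local Notation E := 'rV[R]_d.
Local Notation jet := (jet R d).
Local Notation B := (eball rad : set E).
Local Notation mu := (leb R d).
Local Notation V := (@H1 R d B).
Local Notation N := (@normH1 R d B).
Implicit Types (u v w z phi xi : jet) (x : E).

Let mB : measurable B := @measurable_eball R d rad.

Lemma H1_cmeasurable w : V w -> cmeasurable B w.1.
Proof. by case=> -[]. Qed.

Lemma LooN_ge0 (chi : E -> R) : 0 <= fine (LooN B chi).
Proof. by rewrite fine_ge0// Lnorm_ge0. Qed.

Lemma Loo_bound (chi : E -> R) : Loo chi ->
  {ae mu, forall x, B x -> `|chi x| <= fine (LooN B chi)}.
Proof.
rewrite /Loo /LooN => -[_]; rewrite unlock.
have [T0|T0] := ltP 0%E (mu setT); last first.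
  (* By convention the norm is 0 when the whole space has measure 0, and then
     every property holds almost everywhere. *)
  move=> _; exists setT; split => //.
  by apply/eqP; rewrite eq_le measure_ge0 andbT.
set s := ess_sup _ _ => s_lty; set s' := ess_sup _ _.
have s's : (s' <= s)%E.
  apply: le_ess_sup; apply: nearW => x /=.
  rewrite lee_fin !normrM !indicE in_setT normr1 mulr1 ler_piMr//.
  by case: (_ \in _); rewrite ?normr1// normr0.
have s'0 : (0 <= s')%E.
  by apply: ess_sup_gee => //; apply: nearW => x; exact: abse_ge0.
have s'fin : s' \is a fin_num by rewrite ge0_fin_numE// (le_lt_trans s's).
have := @ess_sup_ge _ _ _ mu (abse \o (fun x => (chi x * \1_B x)%:E)).
apply: filterS => x /= h Bx; rewrite -lee_fin fineK//.
by move: h; rewrite indicE mem_set// mulr1.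
Qed.

Section bounded_weight.
Context (chi : E -> R) (Cprod : R).
Hypotheses (chiL : Loo chi)
  (prod_le : forall w z phi, V w -> V z -> V phi ->
     (LpN 4%:E B w.1 * LpN 4%:E B z.1 * LpN 2%:E B phi.1
       <= (Cprod * N w * N z * N phi)%:E)%E).
Let k := Cprod * fine (LooN B chi).

(* The modulus of the integrands of the source terms. *)
Let weight w z phi x := `|chi x| * (cabs (w.1 x) * cabs (z.1 x) * cabs (phi.1 x)).

Let mcabs w : V w -> measurable_fun B (fun x => cabs (w.1 x)).
Proof.
move=> /H1_cmeasurable[mr mi].
have msqrt : measurable_fun [set: R] (@Num.sqrt R).
  by apply: continuous_measurable_fun; exact: sqrt_continuous.
rewrite (_ : (fun x => _) = @Num.sqrt R \o
    (fun x => complex.Re (w.1 x) ^+ 2 + complex.Im (w.1 x) ^+ 2)).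
  by apply: measurableT_comp => //; apply: measurable_funD; exact: measurable_funX.
by apply/funext => x /=; case: (w.1 x).
Qed.

Let mweight w z phi : V w -> V z -> V phi -> measurable_fun B (weight w z phi).
Proof.
move=> wV zV phiV; apply: measurable_funM.
  by apply: measurableT_comp => //; apply: measurable_funTS; case: chiL.
by apply: measurable_funM; [apply: measurable_funM|]; exact: mcabs.
Qed.

Let product_le w z phi : V w -> V z -> V phi ->
  (\int[mu]_(x in B) (cabs (w.1 x) * cabs (z.1 x) * cabs (phi.1 x))%:E <=
   (Cprod * N w * N z * N phi)%:E)%E.
Proof.
move=> wV zV phiV; apply: le_trans (prod_le wV zV phiV).
pose f w x := cabs (w.1 x) * \1_B x.
have mf v : V v -> measurable_fun setT (f v).
  move=> vV; rewrite (_ : f v = (fun x => cabs (v.1 x)) \_ B).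
    by apply/(measurable_restrictT _ mB); exact: mcabs.
  apply/funext => x; rewrite /f patchE indicE; case: ifP => _; rewrite ?mulr1//.
  by rewrite mulr0.
apply: le_trans (hoelder442 mu (mf _ wV) (mf _ zV) (mf _ phiV)).
rewrite Lnorm1 [leLHS]integral_mkcond le_eqVlt; apply/orP; left; apply/eqP.
apply: eq_integral => x _; rewrite patchE /= /f indicE.
case: ifP => _; rewrite ?mulr1 ?mulr0 ?normr0//.
by rewrite ger0_norm// !mulr_ge0// cabs_ge0.
Qed.

Let weight_le w z phi : V w -> V z -> V phi ->
  (\int[mu]_(x in B) (weight w z phi x)%:E <= (k * N w * N z * N phi)%:E)%E.
Proof.
move=> wV zV phiV.
have c0 := LooN_ge0 chi; set c := fine _ in c0.
pose p x := cabs (w.1 x) * cabs (z.1 x) * cabs (phi.1 x).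
have p0 x : 0 <= p x by rewrite !mulr_ge0// cabs_ge0.
have mp : measurable_fun B (EFin \o p).
  apply/measurable_EFinP.
  by apply: measurable_funM; [apply: measurable_funM|]; exact: mcabs.
apply: (@le_trans _ _ (\int[mu]_(x in B) (c%:E * (p x)%:E))%E).
  apply: ae_ge0_le_integral => //.
  - by move=> x _; rewrite lee_fin; exact: (mulr_ge0 (normr_ge0 _) (p0 x)).
  - by apply/measurable_EFinP; exact: mweight.
  - by move=> x _; rewrite -EFinM lee_fin; exact: (mulr_ge0 c0 (p0 x)).
  - by apply: emeasurable_funM.
  - apply: filterS (Loo_bound chiL) => x h Bx.
    by rewrite -EFinM lee_fin; exact: (ler_wpM2r (p0 x) (h Bx)).
rewrite ge0_integralZl//; [|by move=> x _; rewrite lee_fin].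
rewrite (_ : k * _ * _ * _ = c * (Cprod * N w * N z * N phi)); last first.
  by rewrite /k -/c; ring.
by rewrite EFinM lee_wpmul2l ?lee_fin//; exact: product_le.
Qed.

Let weight_integrable w z phi : V w -> V z -> V phi ->
  mu.-integrable B (EFin \o weight w z phi).
Proof.
move=> wV zV phiV; apply/integrableP; split.
  by apply/measurable_EFinP; exact: mweight.
apply: (@le_lt_trans _ _ (k * N w * N z * N phi)%:E); last exact: ltry.
apply: le_trans (weight_le wV zV phiV); rewrite le_eqVlt; apply/orP; left; apply/eqP.
apply: eq_integral => x _; rewrite /= ger0_norm//.
by rewrite /weight !mulr_ge0 ?normr_ge0 ?cabs_ge0.
Qed.

Section trilinear.
Context (F : E -> R[i]) (w z phi : jet).
Hypotheses (wV : V w) (zV : V z) (phiV : V phi) (mF : cmeasurable B F)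
  (FE : forall x, cabs (F x) = weight w z phi x).

Let F_le x : B x -> cabs (F x) <= weight w z phi x.
Proof. by rewrite FE. Qed.

Lemma trilinear_cintegrable : cintegrable B F.
Proof. exact: (cintegrable_le mB mF (weight_integrable wV zV phiV) F_le). Qed.

Lemma trilinear_cint_le : cabs (cint B F) <= k * N w * N z * N phi.
Proof.
have wi := weight_integrable wV zV phiV.
apply: (le_trans (cabs_cint_le mB mF wi F_le)).
rewrite -lee_fin /Rintegral fineK; last exact: integrable_fin_num.
exact: weight_le.
Qed.

End trilinear.

Let chi_cmeasurable : cmeasurable B (fun x => (chi x)%:C%C).
Proof. by apply: cmeasurable_real; apply: measurable_funTS; case: chiL. Qed.

Let H1c := H1_cmeasurable.

Let measurable1 u v xi : V u -> V v -> V xi ->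
  cmeasurable B (fun x => (chi x)%:C%C * conjc (u.1 x) * v.1 x * conjc (xi.1 x)).
Proof.
move=> uV vV xiV; apply: cmeasurableM; last by apply: cmeasurableJ; exact: H1c.
apply: cmeasurableM; last exact: H1c.
by apply: cmeasurableM => //; apply: cmeasurableJ; exact: H1c.
Qed.

Let modulus1 u v xi x :
  cabs ((chi x)%:C%C * conjc (u.1 x) * v.1 x * conjc (xi.1 x)) = weight u v xi x.
Proof. by rewrite !cabsM !cabsJ cabs_real /weight !mulrA. Qed.

Let integrable1 u v xi : V u -> V v -> V xi ->
  cintegrable B (fun x => (chi x)%:C%C * conjc (u.1 x) * v.1 x * conjc (xi.1 x)).
Proof.
move=> uV vV xiV; apply: (trilinear_cintegrable uV vV xiV).
  exact: measurable1.
exact: modulus1.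
Qed.

Let subV u v : V u -> V v -> V (u - v).
Proof. exact: (subspaceB (@H1_subspace R d rad)). Qed.

Lemma source1_bound u v xi : V u -> V v -> V xi ->
  cabs (source1 rad chi u v xi) <= k * N u * N v * N xi.
Proof.
move=> uV vV xiV; apply: trilinear_cint_le => //; exact: measurable1.
Qed.

Lemma source1_antidual u v : V u -> V v -> antidual V N (source1 rad chi u v).
Proof.
move=> uV vV; split.
  move=> c xi xi' xiV xi'V; rewrite /source1 -cintZ//; last exact: integrable1.
  rewrite -cintD//; last 2 first.
  - apply: (@trilinear_cintegrable _ (c *: u) v xi) => //.
      + by apply: (subspaceZ (@H1_subspace R d rad)).
      + apply: cmeasurableM; last exact: measurable1.
        by split; exact: measurable_cst.
      + move=> x; rewrite cabsM modulus1 /weight cabsJ.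
        by rewrite -[(c *: u).1 x]/(c * u.1 x) cabsM; ring.
  - exact: integrable1.
  congr cint; apply/funext => x.
  rewrite -[(c *: xi + xi').1 x]/(c * xi.1 x + xi'.1 x) rmorphD rmorphM /=.
  ring.
by exists (k * N u * N v) => xi xiV; exact: source1_bound.
Qed.

Lemma source1_lipschitz u v u' v' xi : V u -> V v -> V u' -> V v' -> V xi ->
  cabs (source1 rad chi u v xi - source1 rad chi u' v' xi) <=
  k * (N (u - u') * N v + N u' * N (v - v')) * N xi.
Proof.
move=> uV vV u'V v'V xiV.
have addl : source1 rad chi u v xi =
    source1 rad chi (u - u') v xi + source1 rad chi u' v xi.
  rewrite /source1 -cintD//; [|exact: integrable1 (subV uV u'V) vV xiV|exact: integrable1].
  congr cint; apply/funext => x.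
  rewrite -[(u - u').1 x]/(u.1 x - u'.1 x) rmorphB /=; ring.
have addr : source1 rad chi u' v xi =
    source1 rad chi u' (v - v') xi + source1 rad chi u' v' xi.
  rewrite /source1 -cintD//; [|exact: integrable1 u'V (subV vV v'V) xiV|exact: integrable1].
  congr cint; apply/funext => x.
  rewrite -[(v - v').1 x]/(v.1 x - v'.1 x) /=; ring.
rewrite addl addr addrA addrK (le_trans (cabsD _ _))//.
rewrite mulrDr mulrDl !mulrA lerD//; apply: source1_bound => //; exact: subV.
Qed.

Let measurable2 u v xi : V u -> V v -> V xi ->
  cmeasurable B (fun x => (chi x)%:C%C * (u.1 x * v.1 x) * conjc (xi.1 x)).
Proof.
move=> uV vV xiV; apply: cmeasurableM.
  apply: cmeasurableM => //; apply: cmeasurableM; exact: H1c.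
by apply: cmeasurableJ; exact: H1c.
Qed.

Let modulus2 u v xi x :
  cabs ((chi x)%:C%C * (u.1 x * v.1 x) * conjc (xi.1 x)) = weight u v xi x.
Proof. by rewrite !cabsM cabsJ cabs_real /weight !mulrA. Qed.

Let integrable2 u v xi : V u -> V v -> V xi ->
  cintegrable B (fun x => (chi x)%:C%C * (u.1 x * v.1 x) * conjc (xi.1 x)).
Proof.
move=> uV vV xiV; apply: (trilinear_cintegrable uV vV xiV).
  exact: measurable2.
exact: modulus2.
Qed.

Let source2E u xi : source2 rad chi u xi =
  cint B (fun x => (chi x)%:C%C * (u.1 x * u.1 x) * conjc (xi.1 x)).
Proof. by congr cint; apply/funext => x; rewrite expr2. Qed.

Lemma source2_bound u xi : V u -> V xi ->
  cabs (source2 rad chi u xi) <= k * N u * N u * N xi.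
Proof.
move=> uV xiV; rewrite source2E; apply: trilinear_cint_le => //.
exact: measurable2.
Qed.

Lemma source2_antidual u : V u -> antidual V N (source2 rad chi u).
Proof.
move=> uV; split.
  move=> c xi xi' xiV xi'V; rewrite !source2E -cintZ//; last exact: integrable2.
  rewrite -cintD//; last 2 first.
  - apply: (@trilinear_cintegrable _ (c *: u) u xi) => //.
      + by apply: (subspaceZ (@H1_subspace R d rad)).
      + apply: cmeasurableM; last exact: measurable2.
        by split; exact: measurable_cst.
      + move=> x; rewrite cabsM modulus2 /weight cabsJ.
        by rewrite -[(c *: u).1 x]/(c * u.1 x) cabsM; ring.
  - exact: integrable2.
  congr cint; apply/funext => x.
  rewrite -[(c *: xi + xi').1 x]/(c * xi.1 x + xi'.1 x) rmorphD rmorphM /=.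
  ring.
by exists (k * N u * N u) => xi xiV; exact: source2_bound.
Qed.

(** A difference of squares is a product, to which the same estimate applies. *)
Lemma source2_lipschitz u u' xi : 0 <= Cprod -> V u -> V u' -> V xi ->
  cabs (source2 rad chi u xi - source2 rad chi u' xi) <=
  k * (N (u - u') * (N u + N u')) * N xi.
Proof.
move=> C0 uV u'V xiV.
have uu'V : V (u + u') by exact: (subspaceD (@H1_subspace R d rad)).
pose F x := (chi x)%:C%C * ((u - u').1 x * (u + u').1 x) * conjc (xi.1 x).
have -> : source2 rad chi u xi = cint B F + source2 rad chi u' xi.
  rewrite !source2E -cintD//; [|exact: integrable2 (subV uV u'V) uu'V xiV|exact: integrable2].
  congr cint; apply/funext => x; rewrite /F.
  rewrite -[(u - u').1 x]/(u.1 x - u'.1 x) -[(u + u').1 x]/(u.1 x + u'.1 x); ring.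
rewrite addrK; apply: (@le_trans _ _ (k * N (u - u') * N (u + u') * N xi)).
  apply: trilinear_cint_le => //; first exact: subV.
    by apply: measurable2 => //; exact: subV.
  by move=> x; exact: modulus2.
have N0 w : 0 <= N w by exact: normH1_ge0.
rewrite ler_wpM2r// -mulrA ler_wpM2l ?mulr_ge0 ?LooN_ge0// ler_wpM2l//.
exact: normH1_triangle.
Qed.

End bounded_weight.
End source_terms.

(** * The coupled Helmholtz problems *)

Lemma stability_bound_le (R : realType) (X : lmodType R[i]) (V W : set X)
    (N : X -> R) (a : X -> X -> R[i]) (M M' : R) :
  linear_subspace W -> linear_subspace V -> seminorm_on V N -> M <= M' ->
  stability_bound W N a M -> stability_bound W N a M'.
Proof.
move=> sW sV sN MM' st F aF w wW wF; apply: (le_trans (st F aF w wW wF)).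
by rewrite ler_wpM2r// (dual_norm_ge0 sW sV sN).
Qed.

Theorem theorem3p5 (R : realType) (d : nat) (D : set 'rV[R]_d)
    (rad kappa1 nmin nmax : R) (n1 n2 chi1 chi2 : 'rV[R]_d -> R)
    (d0 : 'rV[R]_d) (M1 M2 Cprod h0 Mlin : R)
    (p : nat) (Th : R -> mesh R d) (Vh : R -> set (jet R d)) :
  d = 2%N \/ d = 3%N ->
  bounded_lipschitz_domain D ->
  0 < rad -> closure D `<=` eball rad ->
  0 < kappa1 ->
  0 < nmin -> refractive_index rad D nmin nmax n1 ->
  refractive_index rad D nmin nmax n2 ->
  susceptibility D chi1 -> susceptibility D chi2 ->
  enorm d0 = 1 ->
  let kappa2 := 2 * kappa1 in
  let B : set 'rV[R]_d := eball rad in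
  let V : set (jet R d) := H1 B in
  let nV : jet R d -> R := normH1 B in
  let a1 := helmholtz_form rad kappa1 n1 in
  let a2 := helmholtz_form rad kappa2 n2 in
  let l := incident_functional rad kappa1 d0 in
  antidual V nV l ->
  antidual_isomorphism V nV (eqH1 B) a1 ->
  antidual_isomorphism V nV (eqH1 B) a2 ->
  0 < M1 -> stability_bound V nV a1 M1 ->
  0 < M2 -> stability_bound V nV a2 M2 ->
  0 < Cprod ->
  (forall w z phi, V w -> V z -> V phi ->
     (LpN 4%:E B w.1 * LpN 4%:E B z.1 * LpN 2%:E B phi.1
       <= (Cprod * nV w * nV z * nV phi)%:E)%E) ->
  (1 <= p)%N ->
  (forall h, 0 < h -> conforming_mesh rad (Th h)) ->
  shape_regular Th ->
  (forall h, 0 < h -> fe_space rad p (Th h) (Vh h)) ->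
  dense_family rad Vh ->
  0 < h0 -> 0 < Mlin ->
  (forall h, 0 < h <= h0 ->
     [/\ uniquely_solvable (Vh h) nV (eqH1 B) a1,
         stability_bound (Vh h) nV a1 Mlin,
         uniquely_solvable (Vh h) nV (eqH1 B) a2 &
         stability_bound (Vh h) nV a2 Mlin]) ->
  let Mhat1 := Num.max M1 Mlin in
  let Mhat2 := Num.max M2 Mlin in
  let c1 := fine (LooN B chi1) in
  let c2 := fine (LooN B chi2) in
  forall rho : R, 0 < rho ->
  Mhat1 * dual_norm V nV l + theta_ Mhat1 Mhat2 Cprod c1 c2 rho * rho <= rho ->
  q_ Mhat1 Mhat2 Cprod c1 c2 rho < 1 ->
  let sigma_rho := sigma_ Mhat2 Cprod c2 rho in
  unique_pair rad (fun u1 u2 =>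
    nonlinear_solution rad a1 a2 l chi1 chi2 V u1 u2 /\
    ball2 rad V rho sigma_rho u1 u2) /\
  (forall h, 0 < h <= h0 ->
     unique_pair rad (fun u1 u2 =>
       nonlinear_solution rad a1 a2 l chi1 chi2 (Vh h) u1 u2 /\
       ball2 rad (Vh h) rho sigma_rho u1 u2)).
Proof.
move=> _ _ _ _ _ _ _ _ [chi1L _ _] [chi2L _ _] _ kappa2 B V nV a1 a2 l.
move=> lV [_ a1l _ solv1] [_ a2l _ solv2] M10 st1 M20 st2 C0 prod_le.
move=> _ _ _ fe _ _ Mlin0 disc Mhat1 Mhat2 c1 c2 rho rho0 rho_self q_lt1 sigma_rho.
have sV := @H1_subspace R d rad; have sN := @normH1_seminorm R d rad.
have Mhat1_ge0 : 0 <= Mhat1 by rewrite le_max (ltW M10).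
have Mhat2_ge0 : 0 <= Mhat2 by rewrite le_max (ltW M20).
have k1_ge0 : 0 <= Cprod * c1 by rewrite mulr_ge0 ?(ltW C0) ?LooN_ge0.
have k2_ge0 : 0 <= Cprod * c2 by rewrite mulr_ge0 ?(ltW C0) ?LooN_ge0.
have sigmaE : sigma_rho = Mhat2 * (Cprod * c2) * rho ^+ 2.
  by rewrite /sigma_rho /sigma_ /beta_; field.
(* Both claims are instances of the problem on a subspace [W]. *)
suff main (W : set (jet R d)) : linear_subspace W -> W `<=` V ->
    uniquely_solvable W nV (eqH1 B) a1 -> stability_bound W nV a1 Mhat1 ->
    uniquely_solvable W nV (eqH1 B) a2 -> stability_bound W nV a2 Mhat2 ->
    unique_pair rad (fun u1 u2 =>
      nonlinear_solution rad a1 a2 l chi1 chi2 W u1 u2 /\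
      ball2 rad W rho sigma_rho u1 u2).
  have le1 : M1 <= Mhat1 /\ Mlin <= Mhat1 by rewrite !le_max !lexx orbT.
  have le2 : M2 <= Mhat2 /\ Mlin <= Mhat2 by rewrite !le_max !lexx orbT.
  split=> [|h hh0].
    exact: (main V sV (@subset_refl _ V)
      solv1 (stability_bound_le sV sV sN le1.1 st1)
      solv2 (stability_bound_le sV sV sN le2.1 st2)).
  have [s1 b1 s2 b2] := disc h hh0; have /andP[h_gt0 _] := hh0.
  have sW := fe_space_subspace (fe h h_gt0).
  exact: (main (Vh h) sW (fe_space_sub (fe h h_gt0))
    s1 (stability_bound_le sW sV sN le1.2 b1)
    s2 (stability_bound_le sW sV sN le2.2 b2)).
move=> sW WV sol1 stab1 sol2 stab2.
have WVl (a : jet R d -> jet R d -> R[i]) :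
    (forall (c : R[i]) w z phi, V w -> V z -> V phi ->
      a (c *: w + z) phi = c * a w phi + a z phi) ->
    forall (c : R[i]) w z phi, W w -> W z -> W phi ->
      a (c *: w + z) phi = c * a w phi + a z phi.
  by move=> al c w z phi /WV ? /WV ? /WV ?; exact: al.
have [||u1 [u2 [[u1W u2W u1r u2s] eq1 eq2 uniq]]] :=
  @coupled_problem_unique_solution _ _ V W nV (eqH1 B) a1 a2 l
    (source1 rad chi1) (source2 rad chi2) Mhat1 Mhat2 (Cprod * c1) (Cprod * c2)
    rho sV sN (@H1_complete R d rad) sW WV (WVl _ a1l) (WVl _ a2l)
    sol1 sol2 stab1 stab2 Mhat1_ge0 Mhat2_ge0 k1_ge0 k2_ge0 lV
    (fun u v uV vV => source1_antidual chi1L prod_le uV vV)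
    (fun u uV => source2_antidual chi2L prod_le uV)
    (fun u v phi => source1_bound chi1L prod_le (u := u) (v := v) (xi := phi))
    (fun u phi => source2_bound chi2L prod_le (u := u) (xi := phi))
    (fun u v u' v' phi uV vV u'V v'V phiV =>
       source1_lipschitz chi1L prod_le uV vV u'V v'V phiV)
    (fun u u' phi uV u'V phiV =>
       source2_lipschitz chi2L prod_le (ltW C0) uV u'V phiV)
    (ltW rho0).
- apply: le_trans rho_self; rewrite lerD2l le_eqVlt; apply/orP; left; apply/eqP.
  by rewrite /theta_ -/sigma_rho sigmaE; ring.
- apply: le_lt_trans q_lt1; rewrite le_eqVlt; apply/orP; left; apply/eqP.
  by rewrite /q_ /theta_ -/sigma_rho sigmaE /alpha_ /beta_; ring.
exists u1, u2; split.
  split; first by split.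
  by split=> //; rewrite sigmaE.
move=> v1 v2 [[v1W v2W eqv1 eqv2] [_ _ v1r v2s]].
have [|v1u v2u] := uniq v1 v2 v1W v2W v1r _ eqv1 eqv2; first by rewrite -sigmaE.
by split; apply: normH1_eq0 => //; exact: WV.
Qed.
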